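(* Define $Q:\mathbb{Z}^2\to\mathbb{R}$ by $Q_{n,m}=(-1)^{mn}$, i.e. $Q_{n,m}=1$ if $m$ or $n$ is even and $Q_{n,m}=-1$ if both $m$ and $n$ are odd, and let $H_\lambda=\Delta_{\mathrm{tri}}+\lambda Q$. For all $\lambda>0$, $\sigma(H_\lambda)$ has two connected components. Moreover, for all $\lambda>0$ sufficiently small, the gap that opens about $E=-2$ (the connected component $\mathfrak{g}_\lambda$ of $\mathbb{R}\setminus\sigma(H_\lambda)$ containing $-2$) is precisely $$\mathfrak{g}_\lambda=\left(-\sqrt{4+\lambda^2},\,-2+\lambda\right).$$ In particular, its length satisfies $|\mathfrak{g}_\lambda|=\lambda+\left(\sqrt{4+\lambda^2}-2\right)\sim\lambda+\frac{\lambda^2}{2}$ as $\lambda\downarrow0$, so the gap opens linearly as $\lambda\downarrow0$.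
   Context: The triangular lattice (vertices $n\bm{a}_1+m\bm{a}_2$, $n,m\in\mathbb{Z}$, with $\bm{a}_1=(1,0)$, $\bm{a}_2=\frac12(1,\sqrt3)$, and edges between vertices at Euclidean distance $1$) is identified with $\mathbb{Z}^2$ via $n\bm{a}_1+m\bm{a}_2\leftrightarrow(n,m)$. Under this identification its Laplacian (adjacency operator) acts on $\ell^2(\mathbb{Z}^2)$ by $[\Delta_{\mathrm{tri}}\psi]_{n,m}=\psi_{n-1,m}+\psi_{n+1,m}+\psi_{n,m-1}+\psi_{n,m+1}+\psi_{n-1,m+1}+\psi_{n+1,m-1}$. The function $Q$ acts by multiplication. $\sigma$ denotes spectrum, and $f(\lambda)\sim g(\lambda)$ means $f(\lambda)/g(\lambda)\to1$ as $\lambda\downarrow0$. *)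

(* Defs.v *)
From HB Require Import structures.
From mathcomp Require Import all_boot all_order all_algebra.
From mathcomp Require Import all_classical all_reals all_analysis.
From mathcomp Require Import complex.

Set Implicit Arguments.
Unset Strict Implicit.
Unset Printing Implicit Defensive.

Import Order.TTheory GRing.Theory Num.Theory.
Import numFieldNormedType.Exports.

Local Open Scope classical_set_scope.
Local Open Scope ring_scope.
Local Open Scope complex_scope.

Notation Z2 := (int * int)%type.

(** * The complex Hilbert space of square-summable functions on Z2 *)

Definition sqnorm2 (R : realType) (psi : Z2 -> R[i]) : \bar R :=
  (\esum_(x in [set: Z2]) (complex.Re `|psi x| ^+ 2)%:E)%E.

Definition ell2 (R : realType) : set (Z2 -> R[i]) :=
  [set psi | (sqnorm2 psi < +oo)%E].

Definition norm2 (R : realType) (psi : Z2 -> R[i]) : R :=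
  Num.sqrt (fine (sqnorm2 psi)).

(** An operator on [ell2] is represented by a map on all functions on [Z2];
    only its values on [ell2] matter in what follows. *)
Definition bounded_operator (R : realType)
    (T : (Z2 -> R[i]) -> (Z2 -> R[i])) : Prop :=
  [/\ forall psi, ell2 psi -> ell2 (T psi),
      forall (a : R[i]) psi phi, ell2 psi -> ell2 phi ->
        T (fun x => a * psi x + phi x) = (fun x => a * T psi x + T phi x)
    & exists M : R, forall psi, ell2 psi -> norm2 (T psi) <= M * norm2 psi].

Definition shift_by (R : realType) (T : (Z2 -> R[i]) -> (Z2 -> R[i]))
    (z : R[i]) (psi : Z2 -> R[i]) : Z2 -> R[i] :=
  fun x => T psi x - z * psi x.

(** [R[i]^o] is the type of complex numbers with its usual topology; the bare
    type [R[i]] carries none. *)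
Definition resolvent_set (R : realType)
    (T : (Z2 -> R[i]) -> (Z2 -> R[i])) : set R[i]^o :=
  [set z | exists2 S : (Z2 -> R[i]) -> (Z2 -> R[i]), bounded_operator S &
     forall psi, ell2 psi ->
       S (shift_by T z psi) = psi /\ shift_by T z (S psi) = psi].

Definition spectrum (R : realType)
    (T : (Z2 -> R[i]) -> (Z2 -> R[i])) : set R[i]^o :=
  ~` resolvent_set T.

Definition components (X : topologicalType) (A : set X) : set (set X) :=
  [set connected_component A x | x in A].

(** * The operator *)

Definition tri_laplacian (R : realType) (psi : Z2 -> R[i]) : Z2 -> R[i] :=
  fun x => let: (n, m) := x in
    psi (n - 1, m) + psi (n + 1, m) + psi (n, m - 1) + psi (n, m + 1)
    + psi (n - 1, m + 1) + psi (n + 1, m - 1).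

Definition potential (R : realType) (x : Z2) : R :=
  let: (n, m) := x in (-1) ^ (m * n).

Definition Htri (R : realType) (l : R) (psi : Z2 -> R[i]) : Z2 -> R[i] :=
  fun x => tri_laplacian psi x + (l * potential R x)%:C * psi x.

Definition gap (R : realType) (l : R) : set R :=
  connected_component (~` [set E : R | spectrum (Htri l) E%:C]) (-2).

Definition gap_length (R : realType) (l : R) : \bar R :=
  lebesgue_measure (gap l).

Definition asymp_equiv0 (R : realType) (f g : R -> R) : Prop :=
  f l / g l @[l --> 0^'+] --> (1 : R).

(* Main.v *)
(* The potential has period 2 in both directions, so by Bloch's theorem H_l is a
   direct integral of 4x4 Hermitian matrices over the torus. In the variable
   u = l - E, with a = 2 cos x, b = 2 cos y, c = 2 cos (x - y), which satisfy
   a^2 + b^2 + c^2 = 4 + abc, the characteristic polynomial is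
     (u - 2)^2 ((u + 2)^2 - 2abc) - (4 - a^2)(4 - b^2)(4 - c^2)
       - 2l (u - 2)(u^2 + 2u - abc).
   Deleting the site with potential -1 leaves a matrix with the constant lowest
   eigenvalue l - 2 (the flat band of the kagome lattice), so by interlacing the
   lowest band lies below l - 2 and the others above. The sign of the polynomial
   shows that the lowest band stays below l/2 - 2, and below - sqrt (4 + l^2) for
   small l; both gap edges are attained at (a, b, c) = (2, 0, 0). Connectedness of
   each half of the Bloch spectrum follows from the intermediate value theorem on
   the torus.

   The Bloch spectrum is contained in the spectrum by exponentially damping Bloch
   waves. Conversely, a point at distance c > 0 from the Bloch spectrum is in the
   resolvent set: on finite tori H_l - z is bounded below by c by the spectral
   theorem, and solutions on growing tori have a pointwise limit along an
   ultrafilter. Hence the spectrum lies between the Bloch spectrum and its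
   closure, which suffices for all the claims. *)
Require Import Defs.
From HB Require Import structures.
From mathcomp Require Import all_boot all_order all_algebra.
From mathcomp Require Import all_classical all_reals all_analysis.
From mathcomp Require Import complex.
From mathcomp Require finmap.
From mathcomp Require Import sesquilinear spectral zify ring lra.
Import Order.TTheory GRing.Theory Num.Theory.
Import numFieldNormedType.Exports.
Local Open Scope classical_set_scope.
Local Open Scope ring_scope.

(** * The characteristic polynomial of the fibre matrices *)

(** The sites of the period cell are ordered [(0,0)], [(1,0)], [(0,1)], [(1,1)], only the last one
    carrying potential [-1]; [a], [b], [c] are the hopping amplitudes along the three lattice
    directions once the Bloch phases are removed. *)
Definition fibre_mx {R : comNzRingType} (l E a b c : R) : 'M[R]_4 :=
  \matrix_(i, j) (nth [::] [:: [:: l - E; a; b; c]; [:: a; l - E; c; b];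
    [:: b; c; l - E; a]; [:: c; b; a; - l - E]] i)`_j.

Definition fibre_det {R : comNzRingType} (l u a b c : R) : R :=
  (u - 2) ^+ 2 * ((u + 2) ^+ 2 - 2 * (a * b * c))
  - (4 - a ^+ 2) * (4 - b ^+ 2) * (4 - c ^+ 2)
  - 2 * l * (u - 2) * (u ^+ 2 + 2 * u - a * b * c).

Lemma det_fibre_mx {R : comNzRingType} (l E a b c : R) :
  a ^+ 2 + b ^+ 2 + c ^+ 2 = 4 + a * b * c ->
  \det (fibre_mx l E a b c) = fibre_det l (l - E) a b c.
Proof.
move=> h.
(* Before the relation is used, the determinant differs from [fibre_det] by an explicit multiple of
   it. *)
have -> : \det (fibre_mx l E a b c) = fibre_det l (l - E) a b c +
   (a ^+ 2 + b ^+ 2 + c ^+ 2 - (4 + a * b * c)) *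
   (a ^+ 2 + b ^+ 2 + c ^+ 2 + a * b * c - 12 - 2 * (l - E) ^+ 2
     + 2 * l * (l - E)).
  rewrite /fibre_det !(expand_det_row _ ord0) !big_ord_recl !big_ord0 /cofactor.
  rewrite !(expand_det_row _ ord0) !big_ord_recl !big_ord0 /cofactor.
  rewrite !(expand_det_row _ ord0) !big_ord_recl !big_ord0 /cofactor.
  rewrite !det_mx11 !mxE /=.
  by rewrite /bump /=; ring.
by rewrite h; ring.
Qed.

Section fibre_sign.
Context {R : realType} (l u a b c : R).
Hypotheses (l0 : 0 < l) (ha : a ^+ 2 <= 4) (hb : b ^+ 2 <= 4)
  (hc : c ^+ 2 <= 4) (habc : a ^+ 2 + b ^+ 2 + c ^+ 2 = 4 + a * b * c).

Lemma fibre_K_ge0 : 0 <= (4 - a ^+ 2) * (4 - b ^+ 2) * (4 - c ^+ 2).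
Proof. by rewrite !mulr_ge0// subr_ge0. Qed.

Lemma fibre_t_le8 : a * b * c <= 8.
Proof. by move: ha hb hc habc; lra. Qed.

Lemma fibre_t_geN4 : - 4 <= a * b * c.
Proof.
by rewrite -subr_ge0 opprK addrC -habc !addr_ge0// sqr_ge0.
Qed.

(** Up to the factor [u - 2] of the flat band, this is the determinant of the block of the three
    sites with potential [1]; for [u > 2] one has [u ^ 2 + 2 * u > 8 >= a * b * c]. *)
Lemma fibre_d_gt0 : 2 < u -> 0 < u ^+ 2 + 2 * u - a * b * c.
Proof. by move=> u2; have := fibre_t_le8; nra. Qed.

Lemma fibre_det_lt0 : 2 < u -> u < 2 + l / 2 -> fibre_det l u a b c < 0.
Proof.
move=> u2 ul; have K := fibre_K_ge0; have t8 := fibre_t_le8.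
have d0 := fibre_d_gt0 u2.
(* Splitting [l] as [2 * (u - 2)] plus a positive remainder turns the determinant into minus a sum
   of terms of known sign. *)
have -> : fibre_det l u a b c =
   - ((u - 2) ^+ 2 * ((3 * u - 2) * (u + 2) - 2 * (a * b * c))
     + (4 - a ^+ 2) * (4 - b ^+ 2) * (4 - c ^+ 2)
     + 2 * (l - 2 * (u - 2)) * (u - 2) * (u ^+ 2 + 2 * u - a * b * c)).
  by rewrite /fibre_det; ring.
rewrite oppr_lt0 ltr_pwDl//.
  rewrite ltr_pwDl// mulr_gt0//; first by rewrite exprn_gt0// subr_gt0.
  nra.
by rewrite !mulr_ge0//; try lra; exact: ltW.
Qed.

(* With [2 * l * u > u ^ 2 - 4] the determinant is compared with its value at
   [2 * l = (u ^ 2 - 4) / u], and for [a b c > 0] the difference is controlled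
   by [(u - 2) ^ 3]. *)
Lemma fibre_det_lt0_small : 2 < u -> u <= 3 -> u ^+ 2 - 2 * l * u < 4 ->
  fibre_det l u a b c < 0.
Proof.
move=> u2 u3 ul; have K := fibre_K_ge0; have t8 := fibre_t_le8.
have t4 := fibre_t_geN4; have d0 := fibre_d_gt0 u2.
set t := a * b * c in t8 t4 d0.
have eK : (4 - a ^+ 2) * (4 - b ^+ 2) * (4 - c ^+ 2) =
   4 * (a ^+ 2 * b ^+ 2 + b ^+ 2 * c ^+ 2 + c ^+ 2 * a ^+ 2)
   - t ^+ 2 - 16 * t.
  transitivity (64 - 16 * (a ^+ 2 + b ^+ 2 + c ^+ 2) +
    4 * (a ^+ 2 * b ^+ 2 + b ^+ 2 * c ^+ 2 + c ^+ 2 * a ^+ 2) - t ^+ 2).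
    by rewrite /t; ring.
  by rewrite habc -/t; ring.
set q := a ^+ 2 * b ^+ 2 + _ + _ in eK.
have q0 : 0 <= q by rewrite !addr_ge0// mulr_ge0// sqr_ge0.
rewrite -(pmulr_rlt0 _ (lt_trans _ u2))//.
have -> : u * fibre_det l u a b c =
  (4 + 2 * l * u - u ^+ 2) * (- (u - 2) * (u ^+ 2 + 2 * u - t)) +
  (t * (- u ^+ 3 + 6 * u ^+ 2 + (t + 4) * u + 8) - 4 * q * u).
  by rewrite /fibre_det eK -/t; ring.
have n0 : - (u - 2) * (u ^+ 2 + 2 * u - t) < 0.
  by rewrite mulNr oppr_lt0 mulr_gt0// subr_gt0.
have h1 : (4 + 2 * l * u - u ^+ 2) * (- (u - 2) * (u ^+ 2 + 2 * u - t)) < 0.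
  rewrite pmulr_rlt0//; lra.
suff : t * (- u ^+ 3 + 6 * u ^+ 2 + (t + 4) * u + 8) - 4 * q * u <= 0 by lra.
have [tn|tp] := leP t 0.
  have g0 : 0 <= - u ^+ 3 + 6 * u ^+ 2 + (t + 4) * u + 8.
    have -> : - u ^+ 3 + 6 * u ^+ 2 + (t + 4) * u + 8 =
      u ^+ 2 * (3 - u) + 3 * u ^+ 2 + (t + 4) * u + 8 by ring.
    rewrite !addr_ge0//; rewrite ?mulr_ge0// ?sqr_ge0//; lra.
  have : t * (- u ^+ 3 + 6 * u ^+ 2 + (t + 4) * u + 8) <= 0 by nra.
  have : 0 <= q * u by rewrite mulr_ge0//; lra.
  lra.
have h2 : t * (- u ^+ 3 + 6 * u ^+ 2 + (t + 4) * u + 8) <=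
          t * ((16 + t) * u).
  rewrite ler_pM2l//.
  have : 0 <= (u - 2) ^+ 3 by rewrite exprn_ge0// subr_ge0 ltW.
  have -> : (u - 2) ^+ 3 = u ^+ 3 - 6 * u ^+ 2 + 12 * u - 8 by ring.
  lra.
(* Nonnegativity of the product [eK], read as [t * (16 + t) <= 4 * q], closes the chain. *)
have h3 : 0 <= (4 * q - t ^+ 2 - 16 * t) * u.
  rewrite mulr_ge0//; last lra.
  by rewrite -eK.
have h4 : t * ((16 + t) * u) + (4 * q - t ^+ 2 - 16 * t) * u = 4 * q * u.
  by ring.
by rewrite subr_le0 -h4 (le_trans h2)// lerDl.
Qed.

End fibre_sign.

Section fibre_mono.
Context {R : realType} (l u v a b c : R).
Hypotheses (ha : a ^+ 2 <= 4) (hb : b ^+ 2 <= 4)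
  (hc : c ^+ 2 <= 4) (habc : a ^+ 2 + b ^+ 2 + c ^+ 2 = 4 + a * b * c).
Hypotheses (v2 : 2 < v) (vu : v < u).

(* [fibre_det] divided by the characteristic polynomial of the three sites
   where the potential is [1] is monotone below their spectrum. *)
Lemma fibre_det_mono :
  fibre_det l v a b c * ((u - 2) * (u ^+ 2 + 2 * u - a * b * c)) <=
  fibre_det l u a b c * ((v - 2) * (v ^+ 2 + 2 * v - a * b * c)).
Proof.
have K := fibre_K_ge0 _ _ _ ha hb hc; have t8 := fibre_t_le8 _ _ _ ha hb hc habc.
have t4 := fibre_t_geN4 _ _ _ habc.
have u2 := lt_trans v2 vu.
have du := fibre_d_gt0 _ _ _ _ ha hb hc habc u2.
have dv := fibre_d_gt0 _ _ _ _ ha hb hc habc v2.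
rewrite -subr_ge0 /fibre_det.
set K0 := (4 - a ^+ 2) * (4 - b ^+ 2) * (4 - c ^+ 2) in K *.
set t := a * b * c in t8 t4 du dv *.
have x0 : 0 < u - 2 by rewrite subr_gt0.
have y0 : 0 < v - 2 by rewrite subr_gt0.
set X := (X in 0 <= X).
(* The difference is [u - v] times a polynomial with nonnegative coefficients in [u - 2], [v - 2],
   [8 - t], [4 + t], [K0] and the two minors, all nonnegative here. *)
have -> : X = (u - v) * ((u - 2) * (v - 2) *
    ((u ^+ 2 + 2 * u - t) * (v ^+ 2 + 2 * v - t) + ((4 + t) * ((u - 2) * (v - 2))
      + 2 * (8 - t) * ((u - 2) + (v - 2)) + (8 - t) ^+ 2))
    + K0 * ((u - 2) ^+ 2 + (u - 2) * (v - 2) + (v - 2) ^+ 2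
      + 6 * ((u - 2) + (v - 2)) + (8 - t))).
  by rewrite /X; ring.
have t80 : 0 <= 8 - t by rewrite subr_ge0.
have t40 : 0 <= 4 + t by rewrite -lerBlDl sub0r.
have uv : 0 < u - v by rewrite subr_gt0.
move: (u - v) (u - 2) (v - 2) (8 - t) (4 + t) (u ^+ 2 + _ - _)
  (v ^+ 2 + _ - _) uv x0 y0 t80 t40 du dv => w p q r r' m m' w0 p0 q0 r0 r'0 m0 m'0.
by do ?[exact: ltW | assumption | exact: sqr_ge0 | exact: ler0n
  | apply: mulr_ge0 | apply: addr_ge0].
Qed.

(** The quotient of [fibre_det] by the positive minor is monotone, so at a fixed momentum its sign
    switches at most once below the energy [l - 2]. *)
Lemma fibre_det_le0_below : fibre_det l u a b c <= 0 -> fibre_det l v a b c <= 0.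
Proof.
move=> h; have m := fibre_det_mono.
have u2 := lt_trans v2 vu.
have du := fibre_d_gt0 _ _ _ _ ha hb hc habc u2.
have dv := fibre_d_gt0 _ _ _ _ ha hb hc habc v2.
rewrite -(@pmulr_lle0 _ ((u - 2) * (u ^+ 2 + 2 * u - a * b * c))).
  by apply: (le_trans m); rewrite pmulr_lle0// mulr_gt0// subr_gt0.
by rewrite mulr_gt0// subr_gt0.
Qed.

Lemma fibre_det_ge0_above : 0 <= fibre_det l v a b c -> 0 <= fibre_det l u a b c.
Proof.
move=> h; have m := fibre_det_mono.
have u2 := lt_trans v2 vu.
have du := fibre_d_gt0 _ _ _ _ ha hb hc habc u2.
have dv := fibre_d_gt0 _ _ _ _ ha hb hc habc v2.
rewrite -(@pmulr_lge0 _ ((v - 2) * (v ^+ 2 + 2 * v - a * b * c))).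
  by apply: (le_trans _ m); rewrite pmulr_lge0// mulr_gt0// subr_gt0.
by rewrite mulr_gt0// subr_gt0.
Qed.

End fibre_mono.

(** * The Bloch spectrum *)

(** The ring is left general because the equations are used over the reals to build Bloch waves and
    over the complex numbers to analyse quasi-periodic functions. *)
Definition fibre_kernel {F : comNzRingType} (l E a b c v0 v1 v2 v3 : F) : Prop :=
  [/\ (E - l) * v0 = a * v1 + b * v2 + c * v3,
      (E - l) * v1 = a * v0 + c * v2 + b * v3,
      (E - l) * v2 = b * v0 + c * v1 + a * v3 &
      (E + l) * v3 = c * v0 + b * v1 + a * v2].

Section fibre_kernel_det.
Context {F : fieldType} (l E a b c : F).
Hypothesis habc : a ^+ 2 + b ^+ 2 + c ^+ 2 = 4 + a * b * c.

Lemma fibre_kernel_row (v : 'rV[F]_4) :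
  v *m fibre_mx l E a b c = 0 <->
  fibre_kernel l E a b c (v 0 0) (v 0 1) (v 0 2%:R) (v 0 3%:R).
Proof.
have e1 : lift 0 0 = 1 :> 'I_4 by apply/val_inj.
have e2 : lift 0 (lift 0 0) = 2%:R :> 'I_4 by apply/val_inj.
have e3 : lift 0 (lift 0 (lift 0 0)) = 3%:R :> 'I_4 by apply/val_inj.
rewrite /fibre_kernel; split => [/rowP vM|[h0 h1 h2 h3]].
  move: (vM 0) (vM 1) (vM 2%:R) (vM 3%:R).
  rewrite !mxE !big_ord_recl !big_ord0 !mxE /= e1 e2 e3.
  set x0 := v _ _; set x1 := v _ _; set x2 := v _ _; set x3 := v _ _.
  move=> h0 h1 h2 h3; split; apply/eqP; rewrite -subr_eq0 -oppr_eq0; apply/eqP.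
  - by rewrite -[RHS]h0; ring.
  - by rewrite -[RHS]h1; ring.
  - by rewrite -[RHS]h2; ring.
  - by rewrite -[RHS]h3; ring.
apply/rowP => j; rewrite !mxE !big_ord_recl !big_ord0 !mxE /= e1 e2 e3.
move: h0 h1 h2 h3.
set x0 := v _ _; set x1 := v _ _; set x2 := v _ _; set x3 := v _ _.
move=> h0 h1 h2 h3.
case: j => -[|[|[|[|//]]]] /= _; rewrite addr0.
- by transitivity (a * x1 + b * x2 + c * x3 - (E - l) * x0);
     [ring|rewrite h0 subrr].
- by transitivity (a * x0 + c * x2 + b * x3 - (E - l) * x1);
     [ring|rewrite h1 subrr].
- by transitivity (b * x0 + c * x1 + a * x3 - (E - l) * x2);
     [ring|rewrite h2 subrr].
- by transitivity (c * x0 + b * x1 + a * x2 - (E + l) * x3);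
     [ring|rewrite h3 subrr].
Qed.

Lemma fibre_det_kernel : fibre_det l (l - E) a b c = 0 ->
  exists v0 v1 v2 v3, fibre_kernel l E a b c v0 v1 v2 v3 /\
    ~ [/\ v0 = 0, v1 = 0, v2 = 0 & v3 = 0].
Proof.
rewrite -det_fibre_mx// => /eqP/det0P[v v0 /fibre_kernel_row vM].
exists (v 0 0), (v 0 1), (v 0 2%:R), (v 0 3%:R); split => // -[h0 h1 h2 h3].
move/eqP: v0; apply; apply/rowP => j; rewrite mxE.
case: j => -[|[|[|[|//]]]] /= lt4;
  [rewrite -h0|rewrite -h1|rewrite -h2|rewrite -h3];
  by congr (v _ _); apply/val_inj.
Qed.

Lemma fibre_kernel_det v0 v1 v2 v3 : fibre_kernel l E a b c v0 v1 v2 v3 ->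
  ~ [/\ v0 = 0, v1 = 0, v2 = 0 & v3 = 0] -> fibre_det l (l - E) a b c = 0.
Proof.
move=> vk vn; rewrite -det_fibre_mx//; apply/eqP/det0P.
pose v := \row_(i < 4) [:: v0; v1; v2; v3]`_i.
exists v; last by apply/fibre_kernel_row; rewrite !mxE.
apply/eqP => /rowP v0'; apply: vn.
by split; [move: (v0' 0)|move: (v0' 1)|move: (v0' 2%:R)|move: (v0' 3%:R)];
  rewrite !mxE.
Qed.

End fibre_kernel_det.

Lemma cos_rel {R : realType} (x y : R) :
  (2 * cos x) ^+ 2 + (2 * cos y) ^+ 2 + (2 * cos (x - y)) ^+ 2 =
  4 + 2 * cos x * (2 * cos y) * (2 * cos (x - y)).
Proof.
rewrite cosB; have := cos2Dsin2 x; have := cos2Dsin2 y.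
move: (cos x) (cos y) (sin x) (sin y) => p q s r hq hp.
have hs : s ^+ 2 = 1 - p ^+ 2 by rewrite -hp; ring.
have hr : r ^+ 2 = 1 - q ^+ 2 by rewrite -hq; ring.
transitivity (4 * (p ^+ 2 + q ^+ 2 + s ^+ 2 * r ^+ 2 - p ^+ 2 * q ^+ 2)
   + 2 * p * (2 * q) * (2 * (p * q + s * r))); first by ring.
by rewrite hs hr; ring.
Qed.

Lemma sqr_2cos_le {R : realType} (x : R) : (2 * cos x) ^+ 2 <= 4.
Proof.
have := cos2Dsin2 x; have := sqr_ge0 (sin x); rewrite exprMn; lra.
Qed.

Definition torus_det {R : realType} (l E x y : R) : R :=
  fibre_det l (l - E) (2 * cos x) (2 * cos y) (2 * cos (x - y)).

Definition bloch_spectrum {R : realType} (l : R) : set R :=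
  [set E | exists x y : R, torus_det l E x y = 0].

(** The largest root of the determinant at momentum zero, where it is [(l - E - 2) ^ 2] times
    [(E - 2) ^ 2 - (l + 2) ^ 2 - 12]. *)
Definition bloch_top {R : realType} (l : R) : R := 2 + Num.sqrt ((l + 2) ^+ 2 + 12).

Section bloch_spectrum.
Context {R : realType} (l : R).
Implicit Types E x y : R.

(** At fixed [E] the determinant is continuous along the straight segment joining the two
    momenta. *)
Lemma bloch_ivt E x0 y0 x1 y1 :
  torus_det l E x0 y0 <= 0 -> 0 <= torus_det l E x1 y1 -> bloch_spectrum l E.
Proof.
move=> h0 h1; pose f (s : R) := torus_det l E (x0 + s * (x1 - x0))
  (y0 + s * (y1 - y0)).
have cf : continuous f.
  have clin (z w : R) : continuous (fun s : R => z + s * w).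
    by move=> s; apply: cvgD; [exact: cvg_cst|apply: cvgMl; exact: cvg_id].
  have ccos (g : R -> R) : continuous g -> continuous (fun s : R => 2 * cos (g s)).
    move=> cg s; apply: cvgMr; apply: (@continuous_comp _ _ _ g cos);
      first exact: cg.
    exact: continuous_cos.
  have cA := ccos _ (clin x0 (x1 - x0)); have cB := ccos _ (clin y0 (y1 - y0)).
  have cC : continuous (fun s : R => 2 * cos (x0 + s * (x1 - x0)
    - (y0 + s * (y1 - y0)))).
    by apply: (ccos (fun s => x0 + s * (x1 - x0) - (y0 + s * (y1 - y0)))) => s;
      apply: cvgB; exact: clin.
  move=> s; rewrite /f /torus_det /fibre_det.
  have sq (g : R -> R) : continuous g -> continuous (fun s : R => g s ^+ 2).
    by move=> cg z; rewrite /continuous_at; under eq_fun do rewrite expr2;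
      apply: cvgM; exact: cg.
  have ABC : continuous (fun s : R => 2 * cos (x0 + s * (x1 - x0))
    * (2 * cos (y0 + s * (y1 - y0)))
     * (2 * cos (x0 + s * (x1 - x0) - (y0 + s * (y1 - y0))))).
    by move=> z; apply: cvgM; [apply: cvgM|]; [exact: cA|exact: cB|exact: cC].
  have K (g : R -> R) : continuous g -> continuous (fun s : R => 4 - g s ^+ 2).
    by move=> cg z; apply: cvgB; [exact: cvg_cst|exact: sq].
  apply: cvgB; [apply: cvgB|].
  - by apply: cvgMr; apply: cvgB; [exact: cvg_cst|apply: cvgMr; exact: ABC].
  - by apply: cvgM; [apply: cvgM|];
    [exact: (K _ cA)|exact: (K _ cB)|exact: (K _ cC)].
  - by apply: cvgMr; apply: cvgB; [exact: cvg_cst|exact: ABC].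
have [|c _ fc] := @IVT R f 0 1 0 ler01 (continuous_subspaceT cf).
  rewrite /f !mul0r !mul1r !addr0 !subrKC.
  by rewrite ge_min h0 le_max h1 orbT.
by exists (x0 + c * (x1 - x0)), (y0 + c * (y1 - y0)).
Qed.

Lemma bloch_gap E : 0 < l -> l / 2 - 2 < E -> E < l - 2 -> ~ bloch_spectrum l E.
Proof.
move=> l0 h1 h2 [x [y /eqP]]; apply/negP; rewrite lt_eqF// fibre_det_lt0 //;
  rewrite ?sqr_2cos_le ?cos_rel//; lra.
Qed.

Lemma bloch_gap_small E : 0 < l -> l < 1 / 2 -> - Num.sqrt (4 + l ^+ 2) < E ->
  E < l - 2 -> ~ bloch_spectrum l E.
Proof.
move=> l0 hl h1 h2 [x [y /eqP]]; apply/negP;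
  rewrite lt_eqF// fibre_det_lt0_small //;
  rewrite ?sqr_2cos_le ?cos_rel//; first lra.
  (* The threshold [l < 1 / 2] is chosen so that [u = l - E] stays below [3]. *)
  have : Num.sqrt (4 + l ^+ 2) <= 5 / 2.
    rewrite -(@ler_pXn2r _ 2)// ?nnegrE ?sqrtr_ge0//.
    rewrite sqr_sqrtr; last by rewrite addr_ge0// sqr_ge0.
    have l2 : l ^+ 2 <= (1 / 2) ^+ 2.
      by rewrite ler_pXn2r// ?nnegrE; [exact: ltW|exact: ltW|lra].
    have -> : (5 / 2) ^+ 2 = 25 / 4 :> R by field.
    have e4 : (1 / 2) ^+ 2 = 1 / 4 :> R by field.
    rewrite e4 in l2; lra.
  lra.
have : E ^+ 2 < 4 + l ^+ 2.
  rewrite -sqrrN -[ltRHS]sqr_sqrtr; last by rewrite addr_ge0// sqr_ge0.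
  rewrite ltr_pXn2r// ?nnegrE ?sqrtr_ge0//; lra.
have -> : (l - E) ^+ 2 - 2 * l * (l - E) = E ^+ 2 - l ^+ 2 by ring.
lra.
Qed.

(** Here [b = c = 0], so the fibre splits into two blocks of size two, with eigenvalues [l - 2],
    [l + 2] and plus or minus [sqrt (4 + l ^ 2)]; both gap edges are among them. *)
Lemma fibre_det_at_2_0_0 E :
  torus_det l E 0 (pi / 2) = ((l - E) ^+ 2 - 4) * (E ^+ 2 - l ^+ 2 - 4).
Proof. by rewrite /torus_det sub0r cosN cos0 cos_pihalf /fibre_det; ring. Qed.

Lemma bloch_edge_low : bloch_spectrum l (- Num.sqrt (4 + l ^+ 2)).
Proof.
exists 0, (pi / 2); rewrite fibre_det_at_2_0_0 sqrrN sqr_sqrtr; first by ring.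
by rewrite addr_ge0// sqr_ge0.
Qed.

Lemma bloch_edge_high : bloch_spectrum l (-2 + l).
Proof. by exists 0, (pi / 2); rewrite fibre_det_at_2_0_0; ring. Qed.

(** By the sign transport in energy, the determinant at [E] is nonpositive at a momentum of [E0] and
    nonnegative at a momentum of [E1]; joining the momenta gives a zero. *)
Lemma bloch_low_interval E0 E E1 : bloch_spectrum l E0 -> bloch_spectrum l E1 ->
  E0 < E -> E < E1 -> E1 < l - 2 -> bloch_spectrum l E.
Proof.
move=> [x0 [y0 h0]] [x1 [y1 h1]] E0E EE1 E1l.
apply: (@bloch_ivt E x0 y0 x1 y1).
  apply: (@fibre_det_le0_below _ l (l - E0) (l - E) _ _ _ (sqr_2cos_le _)
    (sqr_2cos_le _) (sqr_2cos_le _) (cos_rel _ _)); [lra|lra|].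
  by rewrite -/(torus_det _ _ _ _) h0.
apply: (@fibre_det_ge0_above _ l (l - E) (l - E1) _ _ _ (sqr_2cos_le _)
  (sqr_2cos_le _) (sqr_2cos_le _) (cos_rel _ _)); [lra|lra|].
by rewrite -/(torus_det _ _ _ _) h1.
Qed.

Lemma bloch_top_sqr : (bloch_top l - 2) ^+ 2 = (l + 2) ^+ 2 + 12.
Proof. by rewrite /bloch_top addrAC subrr add0r sqr_sqrtr// addr_ge0// sqr_ge0. Qed.

Lemma bloch_top_ge : 0 < l -> l + 4 <= bloch_top l.
Proof.
move=> l0; have h : (l + 2) ^+ 2 <= (bloch_top l - 2) ^+ 2 by
  rewrite bloch_top_sqr lerDl.
have : l + 2 <= bloch_top l - 2.
  rewrite -(@ler_pXn2r _ 2)// nnegrE; first lra.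
  by rewrite /bloch_top addrAC subrr add0r sqrtr_ge0.
lra.
Qed.

(** The determinant is nonpositive at momentum zero on the whole range; it is nonnegative at
    [(0, pi / 2)] while [E ^ 2 <= l ^ 2 + 4], and at a third momentum beyond that. *)
Lemma bloch_high E : 0 < l -> l - 2 <= E -> E <= bloch_top l -> bloch_spectrum l E.
Proof.
move=> l0 h1 h2; have topge := bloch_top_ge l0.
(* With [E >= l - 2] this gives [E - 2 >= - (bloch_top l - 2)], so [E] also lies above the smaller
   root. *)
have topge' : 4 - l <= bloch_top l - 2.
  have [l4|l4] := leP (4 - l) 0; first lra.
  rewrite -(@ler_pXn2r _ 2)// ?nnegrE; [|lra|lra].
  by rewrite bloch_top_sqr sqrrB sqrrD; lra.
have low : torus_det l E 0 0 <= 0.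
  have -> : torus_det l E 0 0 = (l - E - 2) ^+ 2 * ((E - 2)
    ^+ 2 - (bloch_top l - 2) ^+ 2).
    by rewrite bloch_top_sqr /torus_det subr0 cos0 /fibre_det; ring.
  rewrite mulr_ge0_le0 ?sqr_ge0// subr_sqr.
  rewrite mulr_le0_ge0//; lra.
have [Es|Eb] := leP (E ^+ 2) (l ^+ 2 + 4).
  apply: (@bloch_ivt E 0 0 0 (pi / 2) low).
  rewrite fibre_det_at_2_0_0 mulr_le0//; last by rewrite -addrA -opprD subr_le0.
  have : E <= l + 2.
    rewrite leNgt; apply/negP => El.
    have : (l + 2) ^+ 2 < E ^+ 2 by rewrite ltr_pXn2r// ?nnegrE; lra.
    rewrite sqrrD; lra.
  have -> : (l - E) ^+ 2 - 4 = (l - E - 2) * (l - E + 2) by ring.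
  move=> El; rewrite mulr_le0_ge0//; lra.
(* The angle is [2 pi / 3]; at [(x, - x)] one has [a = b = c = -1] and the determinant factors. *)
pose x : R := acos (- 2^-1).
have cx : cos x = - 2^-1 by rewrite acosK// in_itv /=; lra.
apply: (@bloch_ivt E 0 0 x (- x) low).
have -> : torus_det l E x (- x) = (l - E + 1) ^+ 2 * ((E + 1) ^+ 2 - (l - 1)
  ^+ 2 - 3).
  rewrite /torus_det opprK cosN cosD -!expr2 sin2cos2 cx /fibre_det; field => //.
rewrite mulr_ge0 ?sqr_ge0//.
have [En|Ep] := leP E 0.
  have : E ^+ 2 <= (2 - l) ^+ 2.
    by rewrite -sqrrN ler_pXn2r// ?nnegrE; lra.
  rewrite sqrrB; lra.
have -> : (E + 1) ^+ 2 - (l - 1) ^+ 2 - 3 = (E ^+ 2 - (l ^+ 2 + 4))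
  + 2 * E + 2 * l + 1.
  by ring.
lra.
Qed.

(** Since [a], [b], [c] are at most [2] in absolute value, the moduli of a null vector satisfy the
    inequalities of the fibre at momentum zero. Summing the three sites with potential [1] leaves a
    system of size two whose top eigenvalue is [bloch_top l]. *)
Lemma bloch_le_top E : 0 < l -> bloch_spectrum l E -> E <= bloch_top l.
Proof.
move=> l0 [x [y]] /(fibre_det_kernel _ _ _ _ _ (cos_rel x y)) [v0 [v1 [v2 [v3]]]].
move=> -[[h0 h1 h2 h3] vn].
rewrite leNgt; apply/negP => tE; apply: vn.
have El : 0 < E - l by have := bloch_top_ge l0; lra.
have c2 (z w : R) : `|2 * cos z * w| <= 2 * `|w|.
  rewrite !normrM ler_wpM2r// ger0_norm// ler_piMr//.
  by rewrite ler_norml cos_geN1 cos_le1.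
have E3 (p q r s t w z : R) : `|p| <= q -> `|r| <= s -> `|t| <= w ->
  z = p + r + t -> `|z| <= q + s + w.
  move=> pq rs tw ->; rewrite (le_trans (ler_normD _ _))// lerD//.
  by rewrite (le_trans (ler_normD _ _))// lerD.
move: (E3 _ _ _ _ _ _ _ (c2 _ _) (c2 _ _) (c2 _ _) h0).
move: (E3 _ _ _ _ _ _ _ (c2 _ _) (c2 _ _) (c2 _ _) h1).
move: (E3 _ _ _ _ _ _ _ (c2 _ _) (c2 _ _) (c2 _ _) h2).
move: (E3 _ _ _ _ _ _ _ (c2 _ _) (c2 _ _) (c2 _ _) h3).
have El' : 0 < E + l by lra.
rewrite !normrM (gtr0_norm El) (gtr0_norm El') => g3 g2 g1 g0.
(* Completing the square turns this into [E > bloch_top l]. *)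
have key : 12 < (E - l - 4) * (E + l).
  have : (bloch_top l - 2) ^+ 2 < (E - 2) ^+ 2.
    by rewrite ltr_pXn2r// ?nnegrE; have := bloch_top_ge l0; lra.
  have -> : (E - l - 4) * (E + l) = (E - 2) ^+ 2 - (l + 2) ^+ 2 by ring.
  rewrite bloch_top_sqr; lra.
have n0 := normr_ge0 v0; have n1 := normr_ge0 v1; have n2 := normr_ge0 v2.
have n3 := normr_ge0 v3.
set S := `|v0| + `|v1| + `|v2|; have S0 : 0 <= S by rewrite !addr_ge0.
have gS : (E - l - 4) * S <= 6 * `|v3| by rewrite /S; lra.
have gT : (E + l) * `|v3| <= 2 * S by rewrite /S; lra.
have : (E - l - 4) * (E + l) * S <= 12 * S.
  rewrite mulrAC (le_trans (ler_wpM2r (ltW El') gS))//.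
  by rewrite -mulrA (mulrC `|v3|); lra.
rewrite -subr_le0 -mulrBl pmulr_rle0; last by rewrite subr_gt0.
move=> Sn; have {}S0 : S = 0 by apply/eqP; rewrite eq_le Sn S0.
have : `|v3| <= 0 by move: gT; rewrite S0 mulr0 pmulr_rle0.
rewrite normr_le0 => /eqP ->.
have : `|v0| <= 0 by rewrite /S in S0; lra.
have : `|v1| <= 0 by rewrite /S in S0; lra.
have : `|v2| <= 0 by rewrite /S in S0; lra.
by rewrite !normr_le0 => /eqP -> /eqP -> /eqP ->.
Qed.

Lemma bloch_high_interval E0 E E1 : 0 < l -> l - 2 <= E0 -> bloch_spectrum l E1 ->
  E0 < E -> E < E1 -> bloch_spectrum l E.
Proof. by move=> l0 h /(bloch_le_top _ l0) h1 h2 h3; apply: bloch_high; lra. Qed.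

End bloch_spectrum.

Local Open Scope complex_scope.

(** * Square-summable functions *)

Section sqmod.
Context {R : realType}.
Implicit Types z w : R[i].

Definition sqmod z : R := complex.Re z ^+ 2 + complex.Im z ^+ 2.

Lemma sqmodE z : complex.Re `|z| ^+ 2 = sqmod z.
Proof. by rewrite normc_def /= sqr_sqrtr// addr_ge0// sqr_ge0. Qed.

Lemma sqmod_ge0 z : 0 <= sqmod z.
Proof. by rewrite addr_ge0// sqr_ge0. Qed.

Lemma sqmod_eq0 z : sqmod z = 0 -> z = 0.
Proof.
move/eqP; rewrite paddr_eq0 ?sqr_ge0// !sqrf_eq0 => /andP[/eqP a0 /eqP b0].
by apply/eqP; rewrite eq_complex a0 b0 eqxx.
Qed.

Lemma sqmod0 : sqmod 0 = 0.
Proof. by rewrite /sqmod /= expr0n addr0. Qed.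

Lemma sqmodM z w : sqmod (z * w) = sqmod z * sqmod w.
Proof. by case: z w => [a b] [c d]; rewrite /sqmod /=; ring. Qed.

Lemma sqmod_real (x : R) : sqmod x%:C = x ^+ 2.
Proof. by rewrite /sqmod /= expr0n addr0. Qed.

Lemma sqmodD z w : sqmod (z + w) <= 2 * (sqmod z + sqmod w).
Proof.
case: z w => [a b] [c d]; rewrite /sqmod /=.
have := sqr_ge0 (a - c); have := sqr_ge0 (b - d); rewrite !sqrrB !sqrrD; lra.
Qed.

(** The constant is crude, coming from iterating [sqmodD]; it is only applied to sums over the six
    neighbours. *)
Lemma sqmod_sum {I : Type} (s : seq I) (F : I -> R[i]) :
  sqmod (\sum_(i <- s) F i) <= 2 ^+ size s * \sum_(i <- s) sqmod (F i).
Proof.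
elim: s => [|i s IH]; first by rewrite !big_nil sqmod0 mulr0.
rewrite !big_cons /= exprS (le_trans (sqmodD _ _))// -mulrA ler_wpM2l//.
rewrite mulrDr lerD// ler_peMl ?sqmod_ge0//.
by rewrite exprn_ege1// ler1n.
Qed.

End sqmod.

Lemma ler_sum_subset {R : numDomainType} {I : eqType} (s t : seq I) (f : I -> R) :
  uniq s -> {subset s <= t} -> (forall i, 0 <= f i) ->
  \sum_(i <- s) f i <= \sum_(i <- t) f i.
Proof.
move=> us st f0; elim: s t us st => [|x s IH] t.
  by rewrite big_nil sumr_ge0.
rewrite cons_uniq => /andP[xs us] st.
have xt : x \in t by apply: st; rewrite mem_head.
rewrite (perm_big _ (perm_to_rem xt)) !big_cons lerD2l IH// => y ys.
have : y \in t by apply: st; rewrite inE ys orbT.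
rewrite (perm_mem (perm_to_rem xt)) inE => /predU1P[yx|//].
by rewrite yx (negPf xs) in ys.
Qed.

Section mass.
Context {R : realType}.
Implicit Types (psi phi : Z2 -> R[i]) (C : R).

(** Norm bounds are handled through finite partial sums, which keeps the estimates in [R];
    [ell2_mass_le] and [mass_le_norm2] translate to and from [norm2]. *)
Definition mass_le psi C :=
  forall s : seq Z2, uniq s -> \sum_(x <- s) sqmod (psi x) <= C.

Lemma sqnorm2_ge0 psi : (0 <= sqnorm2 psi)%E.
Proof. by apply: esum_ge0 => x _; rewrite lee_fin sqmodE sqmod_ge0. Qed.

Lemma norm2_sqr psi : norm2 psi ^+ 2 = fine (sqnorm2 psi).
Proof. by rewrite sqr_sqrtr// fine_ge0// sqnorm2_ge0. Qed.

Lemma mass_le_sqnorm2 psi C : mass_le psi C -> (sqnorm2 psi <= C%:E)%E.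
Proof.
move=> h; apply: ge_ereal_sup => _ [X [finX _] <-].
rewrite fsbig_finite//= sumEFin lee_fin.
under eq_bigr do rewrite sqmodE.
exact/h/finmap.fset_uniq.
Qed.

Lemma mass_le_ell2 psi C : mass_le psi C -> ell2 psi.
Proof. by move/mass_le_sqnorm2 => h; apply: (le_lt_trans h); rewrite ltry. Qed.

Lemma ell2_fin psi : ell2 psi -> sqnorm2 psi \is a fin_num.
Proof. by move=> h; rewrite ge0_fin_numE ?sqnorm2_ge0. Qed.

Lemma mass_le_norm2 psi C : mass_le psi C -> norm2 psi ^+ 2 <= C.
Proof.
move=> h; rewrite norm2_sqr -lee_fin fineK ?mass_le_sqnorm2//.
exact/ell2_fin/(mass_le_ell2 _ _ h).
Qed.

Lemma ell2_mass_le psi : ell2 psi -> mass_le psi (norm2 psi ^+ 2).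
Proof.
move=> h s us; rewrite norm2_sqr -lee_fin fineK ?ell2_fin// -sumEFin.
apply: esum_ge; exists [set` s]; first by split => //; exact: finite_seq.
rewrite fsbig_seq// le_eqVlt; apply/orP; left; apply/eqP.
by apply: eq_fsbigr => x _; rewrite sqmodE.
Qed.

(** Translating a duplicate-free list of sites keeps it duplicate-free, so each of the [size s]
    shifts contributes at most [C]. This is the boundedness estimate for finite-range operators. *)
Lemma mass_le_dom (k C : R) (s : seq Z2) psi phi : 0 <= k -> mass_le psi C ->
  (forall x, sqmod (phi x) <= k * \sum_(e <- s) sqmod (psi (x + e))) ->
  mass_le phi (k * (size s)%:R * C).
Proof.
move=> k0 h dom t ut; apply: (le_trans (ler_sum _ (fun x _ => dom x))).
rewrite -mulr_sumr -mulrA ler_wpM2l// exchange_big /=.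
apply: (@le_trans _ _ (\sum_(e <- s) C)); last first.
  by rewrite big_const_seq count_predT iter_addr_0 mulr_natl.
apply: ler_sum => e _.
rewrite -(big_map (fun x => x + e) xpredT (fun y => sqmod (psi y))).
by apply: h; rewrite map_inj_uniq//; exact: addIr.
Qed.

(** Otherwise every finite set misses a disjoint one of mass above [eps], so all partial sums stay
    below the squared norm minus [eps], which is absurd. *)
Lemma ell2_tail psi (eps : R) : ell2 psi -> 0 < eps ->
  exists2 s0 : seq Z2, uniq s0 & forall s, uniq s -> ~~ has (mem s0) s ->
    \sum_(x <- s) sqmod (psi x) <= eps.
Proof.
move=> psi2 e0; apply: contrapT => nex.
have /mass_le_norm2 : mass_le psi (norm2 psi ^+ 2 - eps).
  move=> s0 us0; rewrite leNgt; apply/negP => lt0; apply: nex.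
  exists s0 => // s us disj.
  have := ell2_mass_le psi psi2 (s0 ++ s).
  rewrite cat_uniq us0 disj us big_cat /= => /(_ isT); lra.
by rewrite lerBrDr gerDl leNgt e0.
Qed.

End mass.

Definition nbrs : seq Z2 := [:: (-1, 0); (1, 0); (0, -1); (0, 1); (-1, 1); (1, -1)].

Lemma tri_laplacianE {R : realType} (psi : Z2 -> R[i]) x :
  tri_laplacian psi x = \sum_(e <- nbrs) psi (x + e).
Proof.
case: x => n m.
have e (a b : int) : (n, m) + (a, b) = (n + a, m + b) :> Z2 by [].
by rewrite /nbrs !big_cons big_nil !e !addr0 !addrA.
Qed.

Section shift_bound.
Context {R : realType} (l : R).

Lemma HtriE (psi : Z2 -> R[i]) x :
  Htri l psi x = \sum_(e <- nbrs) psi (x + e) + (l * potential R x)%:C * psi x.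
Proof. by rewrite /Htri tri_laplacianE. Qed.

Lemma potential_sqr x : potential R x ^+ 2 = 1.
Proof. by case: x => n m; rewrite /potential expr2 -expfzMl mulrNN mulr1
  exp1rz. Qed.

(** The values enter as an arbitrary function of the offset, so the same estimate serves on the
    lattice and on finite tori. *)
Lemma sqmod_local (z : R[i]) (v : R) (a : Z2 -> R[i]) :
  sqmod (\sum_(e <- nbrs) a e + v%:C * a 0 - z * a 0) <=
  2 * (2 ^+ 6 + 2 * (v ^+ 2 + sqmod z)) * \sum_(e <- 0 :: nbrs) sqmod (a e).
Proof.
rewrite -addrA -mulrBl (le_trans (sqmodD _ _))// -mulrA ler_wpM2l//.
rewrite [X in _ <= _ * X]big_cons.
set A := \sum_(e <- nbrs) sqmod _.
have A0 : 0 <= A by rewrite sumr_ge0// => *; exact: sqmod_ge0.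
have P0 := sqmod_ge0 (a 0).
have h1 : sqmod (\sum_(e <- nbrs) a e) <= 2 ^+ 6 * A by exact: sqmod_sum.
have h2 : sqmod ((v%:C - z) * a 0) <= 2 * (v ^+ 2 + sqmod z) * sqmod (a 0).
  rewrite sqmodM ler_wpM2r// (le_trans (sqmodD _ _))// ler_wpM2l//.
  by rewrite sqmod_real lerD2l -mulN1r sqmodM
    /sqmod /= oppr0 sqrrN expr0n expr1n addr0 mul1r.
rewrite (le_trans (lerD h1 h2))//.
have lz : 0 <= 2 * (v ^+ 2 + sqmod z) by rewrite mulr_ge0//
  addr_ge0 ?sqr_ge0 ?sqmod_ge0.
move: (2 * (v ^+ 2 + _)) lz => k k0.
have := mulr_ge0 k0 A0.
have : 0 <= 2 ^+ 6 * sqmod (a 0) by rewrite mulr_ge0// exprn_ge0.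
by rewrite mulrDl !mulrDr; lra.
Qed.

Lemma ell2_shift_by (z : R[i]) psi : ell2 psi -> ell2 (shift_by (Htri l) z psi).
Proof.
move=> /ell2_mass_le h.
apply: (mass_le_ell2 _ _ (mass_le_dom (2 * (2 ^+ 6 + 2 * (l ^+ 2 + sqmod z))) _
  (0 :: nbrs) _ (shift_by (Htri l) z psi) _ h _)).
  rewrite mulr_ge0// addr_ge0 ?exprn_ge0// mulr_ge0// addr_ge0 ?sqmod_ge0//.
  exact: sqr_ge0.
move=> x; rewrite /shift_by HtriE.
have := sqmod_local z (l * potential R x) (fun e => psi (x + e)).
by rewrite exprMn potential_sqr mulr1 addr0.
Qed.

End shift_bound.

(** * Bounded generalized eigenfunctions *)

Section exponential_weight.
Context {R : realType} (q : R).
Hypothesis q1 : 1 < q.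

Definition weight (x : Z2) : R := q^-1 ^+ (`|x.1| + `|x.2|)%N.

Let qi0 : 0 < q^-1.
Proof. by rewrite invr_gt0 (lt_trans _ q1). Qed.

Let qi1 : q^-1 < 1.
Proof. by rewrite invf_lt1// (lt_trans _ q1). Qed.

Lemma weight_gt0 x : 0 < weight x.
Proof. by rewrite exprn_gt0. Qed.

(** A step to a neighbour changes the sum of the absolute coordinates by at most [2], hence the
    weight by a factor between [q ^ -2] and [q ^ 2]. *)
Lemma weight_nbr x e : e \in nbrs ->
  `|weight x - weight (x + e)| <= (q ^+ 2 - 1) * weight (x + e).
Proof.
move=> he.
have [k1 k2] : (`|x.1| + `|x.2| <= `|(x + e)%R.1| + `|(x + e)%R.2| + 2)%N /\
   (`|(x + e)%R.1| + `|(x + e)%R.2| <= `|x.1| + `|x.2| + 2)%N.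
  case: x => n m; rewrite /nbrs !inE in he.
  by do 5?[case/predU1P: he => [->|he]]; last move/eqP: he => ->;
    rewrite /=; lia.
have mono (i j : nat) : (i <= j + 2)%N -> q^-1 ^+ j <= q ^+ 2 * q^-1 ^+ i.
  move=> ij; have -> : q^-1 ^+ j = q ^+ 2 * q^-1 ^+ (j + 2).
    by rewrite exprD mulrCA -exprMn divff ?expr1n ?mulr1// gt_eqF// (lt_trans _ q1).
  by rewrite ler_wpM2l ?sqr_ge0// ler_wiXn2l// ltW.
have := mono _ _ k1; have := mono _ _ k2.
rewrite -/(weight x) -/(weight (x + e)).
have q21 : 1 < q ^+ 2 by rewrite exprn_egt1.
move: (weight_gt0 x) (weight_gt0 (x + e)) q21.
move: (q ^+ 2) (weight x) (weight (x + e)) => Q A B A0 B0 Q1 AB BA.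
rewrite ler_norml; apply/andP; split; last by rewrite mulrBl mul1r lerD2r.
rewrite -subr_ge0 -(pmulr_rge0 _ (lt_trans ltr01 Q1)).
have := mulr_ge0 (sqr_ge0 (Q - 1)) (ltW B0); nra.
Qed.

Lemma sum_exp_nat_le (p : R) (s : seq nat) : 0 < p -> p < 1 -> uniq s ->
  \sum_(k <- s) p ^+ k <= (1 - p)^-1.
Proof.
move=> p0 p1 us.
pose N := (\max_(k <- s) k).+1.
apply: (@le_trans _ _ (\sum_(k <- index_iota 0 N) p ^+ k)).
  apply: ler_sum_subset => // [k ks|k]; last by rewrite exprn_ge0// ltW.
  by rewrite mem_index_iota /= ltnS; exact: (@leq_bigmax_seq _ s xpredT id).
have := @geometric_le_lim _ N 1 p ler01 p0.
rewrite (gtr0_norm p0) mul1r => /(_ p1); apply: le_trans.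
by rewrite /series/= le_eqVlt; apply/orP; left; apply/eqP/eq_bigr => k _;
  rewrite mul1r.
Qed.

Lemma sum_exp_int_le (p : R) (s : seq int) : 0 < p -> p < 1 -> uniq s ->
  \sum_(k <- s) p ^+ `|k|%N <= 2 * (1 - p)^-1.
Proof.
move=> p0 p1 us; rewrite (bigID (fun k : int => 0 <= k)) /= mulr_natl mulr2n.
have aux (P : pred int) : {in P &, injective (fun k : int => `|k|%N)} ->
    \sum_(k <- s | P k) p ^+ `|k|%N <= (1 - p)^-1.
  move=> inj; rewrite -big_filter -(big_map (fun k : int => `|k|%N)
    xpredT (fun k => p ^+ k)).
  apply: sum_exp_nat_le => //; rewrite map_inj_in_uniq ?filter_uniq// => a b.
  by rewrite !mem_filter => /andP[Pa _] /andP[Pb _]; apply: inj.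
apply: lerD; apply: aux => -[a|a] [b|b]; rewrite !unfold_in /=; try by [].
  by move=> _ _ ->.
by move=> _ _ [->].
Qed.

Lemma sum_exp_Z2_le (p : R) (s : seq Z2) : 0 < p -> p < 1 -> uniq s ->
  \sum_(x <- s) p ^+ (`|x.1| + `|x.2|)%N <= (2 * (1 - p)^-1) ^+ 2.
Proof.
move=> p0 p1 us.
(* The list is enlarged to the product of its two projections, over which the double sum factors. *)
pose s1 := undup (map fst s); pose s2 := undup (map snd s).
apply: (@le_trans _ _ (\sum_(x <- [seq (a, b) | a <- s1, b <- s2])
    p ^+ (`|x.1| + `|x.2|)%N)).
  apply: ler_sum_subset => // [[a b] xs|x]; last by rewrite exprn_ge0// ltW.
  apply/allpairsP; exists (a, b) => /=; rewrite !mem_undup; split => //.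
  - by apply/mapP; exists (a, b).
  - by apply/mapP; exists (a, b).
rewrite big_allpairs /=.
under eq_bigr do (under eq_bigr do rewrite exprD; rewrite -mulr_sumr).
rewrite -mulr_suml expr2.
have nn (t : seq int) : 0 <= \sum_(k <- t) p ^+ `|k|%N.
  by rewrite sumr_ge0// => k _; rewrite exprn_ge0// ltW.
by rewrite ler_pM// sum_exp_int_le// undup_uniq.
Qed.

Lemma ell2_weight (psi : Z2 -> R[i]) (B : R) : (forall x, sqmod (psi x) <= B) ->
  ell2 (fun x => psi x * (weight x)%:C).
Proof.
move=> psiB; have B0 : 0 <= B := le_trans (sqmod_ge0 _) (psiB 0).
apply: (mass_le_ell2 _ (B * (2 * (1 - q^-1 ^+ 2)^-1) ^+ 2)) => s us.
apply: (@le_trans _ _ (B * \sum_(x <- s) (q^-1 ^+ 2) ^+ (`|x.1| + `|x.2|)%N)).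
  rewrite mulr_sumr; apply: ler_sum => x _.
  by rewrite sqmodM sqmod_real /weight exprAC ler_wpM2r// exprn_ge0//
    exprn_ge0// ltW.
by rewrite ler_wpM2l// sum_exp_Z2_le ?exprn_gt0// exprn_ilt1// ltW.
Qed.

End exponential_weight.

(* Damping a bounded solution by a slowly decaying weight yields approximate
   eigenfunctions, because [H - E] moves the weight by a small relative amount. *)
Lemma bounded_solution_spectrum {R : realType} (l E B : R) (psi : Z2 -> R[i]) :
  (forall x, sqmod (psi x) <= B) -> (forall x, Htri l psi x = E%:C * psi x) ->
  (exists x, psi x <> 0) -> spectrum (Htri l) E%:C.
Proof.
move=> psiB psiE [x0 psi0] [S [S2 _ [M SM]] SH].
(* [2 ^ 6] comes from [sqmod_sum] over the neighbours and [6] from counting their shifts in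
   [mass_le_dom]. *)
pose K := M ^+ 2 * (2 ^+ 6 * 6).
have K0 : 0 <= K by rewrite mulr_ge0 ?sqr_ge0.
(* A bounded inverse would control the damped wave by the error that the damping creates. *)
have small (q : R) : 1 < q -> 1 <= (q ^+ 2 - 1) ^+ 2 * K.
  move=> q1; rewrite leNgt; apply/negP => lt1.
  pose phi x := psi x * (weight q x)%:C.
  have phi2 : ell2 phi by exact: ell2_weight psiB.
  have eta2 := ell2_shift_by l E%:C phi phi2.
  have [Sphi _] := SH phi phi2.
  have dom x : sqmod (shift_by (Htri l) E%:C phi x) <=
      2 ^+ 6 * (q ^+ 2 - 1) ^+ 2 * \sum_(e <- nbrs) sqmod (phi (x + e)).
    (* Energy and potential cancel by the equation for [psi], leaving only differences of
       weights. *)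
    have -> : shift_by (Htri l) E%:C phi x =
        \sum_(e <- nbrs) psi (x + e) * (weight q (x + e) - weight q x)%:C.
      have := psiE x; rewrite /shift_by !HtriE /phi => h.
      transitivity (\sum_(e <- nbrs) psi (x + e) * (weight q (x + e))%:C -
        (\sum_(e <- nbrs) psi (x + e)) * (weight q x)%:C).
        have -> : \sum_(e <- nbrs) psi (x + e) =
          E%:C * psi x - (l * potential R x)%:C * psi x by rewrite -h addrK.
        by ring.
      rewrite mulr_suml -sumrB; apply: eq_bigr => e _.
      by rewrite rmorphB mulrBr.
    rewrite (le_trans (sqmod_sum _ _))// -mulrA ler_wpM2l// mulr_sumr.
    rewrite big_seq [leRHS]big_seq; apply: ler_sum => e he.
    rewrite /phi !sqmodM !sqmod_real [leRHS]mulrCA; apply: ler_wpM2l;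
      first exact: sqmod_ge0.
    rewrite -exprMn -[leLHS]real_normK ?num_real// ler_pXn2r ?nnegrE//.
      by rewrite distrC weight_nbr.
    by rewrite mulr_ge0// ?ltW ?weight_gt0// subr_gt0 exprn_egt1.
  have := mass_le_norm2 _ _ (mass_le_dom _ _ _ _ _ _ (ell2_mass_le _ phi2) dom).
  move=> /(_ _)h; have {}h : norm2 (shift_by (Htri l) E%:C phi) ^+ 2 <=
     2 ^+ 6 * (q ^+ 2 - 1) ^+ 2 * 6 * norm2 phi ^+ 2.
    by apply: h; rewrite mulr_ge0 ?sqr_ge0.
  have n2 : norm2 phi ^+ 2 <= (q ^+ 2 - 1) ^+ 2 * K * norm2 phi ^+ 2.
    have := SM _ eta2; rewrite Sphi => h2.
    have : norm2 phi ^+ 2 <= (M * norm2 (shift_by (Htri l) E%:C phi)) ^+ 2.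
      by rewrite ler_pXn2r ?nnegrE ?sqrtr_ge0// (le_trans _ h2) ?sqrtr_ge0.
    rewrite exprMn => /le_trans; apply.
    rewrite (le_trans (ler_wpM2l (sqr_ge0 _) h))// /K le_eqVlt; apply/orP; left.
    by apply/eqP; ring.
  have /eqP : norm2 phi ^+ 2 = 0.
    apply/eqP; rewrite eq_le sqr_ge0 andbT leNgt; apply/negP => n0.
    by move: n2; rewrite leNgt gtr_pMl// lt1.
  move/eqP => n0; have := ell2_mass_le _ phi2 [:: x0] isT.
  rewrite big_seq1 n0 => p0; apply: psi0.
  have /sqmod_eq0/eqP : sqmod (phi x0) = 0.
    by apply/eqP; rewrite eq_le p0 sqmod_ge0.
  rewrite mulf_eq0 => /orP[/eqP//|].
  by rewrite -[0]/(0%:C) (inj_eq (@complexI _)) gt_eqF// weight_gt0.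
(* With [q = 1 + d] and [d < 1] one has [q ^ 2 - 1 <= 3 * d]; this [d] makes both [3 * d] and
   [3 * d * K] smaller than [1]. *)
pose d := (1 + 3 * (K + 1))^-1.
have d0 : 0 < d by rewrite invr_gt0; lra.
have d1 : d < 1 by rewrite invf_lt1; lra.
have dK : d * (1 + 3 * (K + 1)) = 1 by rewrite mulVf// gt_eqF//; lra.
have := small (1 + d); rewrite ltrDl => /(_ d0).
apply/negP; rewrite -ltNge.
have e1 : (1 + d) ^+ 2 - 1 <= 3 * d by rewrite sqrrD; nra.
have e0 : 0 <= (1 + d) ^+ 2 - 1 by rewrite sqrrD; have := sqr_ge0 d; lra.
have e2 : ((1 + d) ^+ 2 - 1) ^+ 2 <= (3 * d) ^+ 2 by
  rewrite ler_pXn2r ?nnegrE//; lra.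
apply: (le_lt_trans (ler_wpM2r K0 e2)).
have -> : (3 * d) ^+ 2 * K = 3 * d * (3 * d * K) by ring.
have dK0 : 0 <= d * K by rewrite mulr_ge0// ltW.
have dK1 : 3 * d * K < 1 by lra.
have d30 : 0 <= 3 * d by lra.
have := ler_wpM2l d30 (ltW dK1); lra.
Qed.

(** * Symmetric kernels on a finite set *)

(** The family preserves the [a]-eigenspace of [A] and its restrictions still commute; a common
    eigenvector of these restrictions has the prescribed eigenvalue for [A]. *)
Lemma common_eigenvector_at {C : numClosedFieldType} n (A : 'M[C]_n) (a : C)
    (Bs : seq 'M[C]_n) :
  eigenvalue A a -> {in Bs, forall B, comm_mx A B} ->
  {in Bs &, forall B B', comm_mx B B'} ->
  exists v : 'rV_n, [/\ v != 0, v *m A = a *: v &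
    {in Bs, forall B, exists b, v *m B = b *: v}].
Proof.
move=> aA AB BB; set V := eigenspace A a.
have VB B : B \in Bs -> stablemx V B.
  by move=> BBs; apply: comm_mx_stable_eigenspace; exact: AB.
have [||v v0 /allP vB] := @common_eigenvector _ _ [seq restrictmx V B | B <- Bs].
- by rewrite lt0n mxrank_eq0.
- move=> _ _ /mapP[B hB ->] /mapP[B' hB' ->].
  by rewrite /comm_mx -!conjmxM ?inE ?stablemx_row_base ?VB// BB.
exists (v *m row_base V); split.
- by rewrite mulmx_free_eq0 ?row_base_free.
- by apply/eigenspaceP; rewrite mulmx_sub// eq_row_base.
- move=> B hB; have : stablemx (v *m row_base V) B.
    by rewrite -stablemx_restrict ?VB//; apply: vB; apply/mapP; exists B.
  by move/eigenvectorP => [b /eigenspaceP]; exists b.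
Qed.

Section finite_kernel.
Local Open Scope sesquilinear_scope.
Context {C : numClosedFieldType} {T : finType}.
Implicit Types (K : T -> T -> C) (f : T -> C).

(** Functions become row vectors, so the matrix acts from the right and sums over the first argument
    of the kernel. *)
Definition kernel_mx K : 'M[C]_#|T| := \matrix_(i, j) K (enum_val i) (enum_val j).
Definition fun_row f : 'rV[C]_#|T| := \row_i f (enum_val i).

Lemma fun_row_surj (v : 'rV[C]_#|T|) : exists f, v = fun_row f.
Proof.
by exists (fun t => v 0 (enum_rank t)); apply/rowP => i; rewrite mxE enum_valK.
Qed.

Lemma fun_row_kernel K f :
  fun_row f *m kernel_mx K = fun_row (fun t => \sum_s f s * K s t).
Proof.
apply/rowP => j; rewrite !mxE [RHS](reindex _ (onW_bij _ (@enum_val_bij T))) /=.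
by apply: eq_bigr => i _; rewrite !mxE.
Qed.

Lemma eq_mx_fun_row (A B : 'M[C]_#|T|) :
  (forall f, fun_row f *m A = fun_row f *m B) -> A = B.
Proof.
move=> h; apply/row_matrixP => i; rewrite !rowE.
by have [f ->] := fun_row_surj (delta_mx 0 i).
Qed.

Lemma fun_row_eq f g : fun_row f = fun_row g -> f =1 g.
Proof. by move/rowP => h t; have := h (enum_rank t); rewrite !mxE enum_rankK. Qed.

Lemma fun_rowZ a f : a *: fun_row f = fun_row (fun t => a * f t).
Proof. by apply/rowP => i; rewrite !mxE. Qed.

Definition perm_kernel (p : T -> T) : T -> T -> C := fun s t => (s == p t)%:R.

Lemma fun_row_perm p f :
  fun_row f *m kernel_mx (perm_kernel p) = fun_row (f \o p).
Proof.
rewrite fun_row_kernel; apply/rowP => i; rewrite !mxE (bigD1 (p (enum_val i)))//=.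
rewrite /perm_kernel eqxx mulr1 big1 ?addr0// => s /negPf ->; by rewrite mulr0.
Qed.

Lemma sqnorm_unitary n (P : 'M[C]_n) (v : 'rV[C]_n) : P \is unitarymx ->
  \sum_i `|(v *m P) 0 i| ^+ 2 = \sum_i `|v 0 i| ^+ 2.
Proof.
move=> /unitarymxP PP.
have e (w : 'rV[C]_n) : \sum_i `|w 0 i| ^+ 2 = (w *m w^t*) 0 0.
  by rewrite mxE; apply: eq_bigr => i _; rewrite !mxE normCK.
by rewrite !e trmx_mul map_mxM mulmxA mulmxtVK// qualifE /= PP.
Qed.

(* The spectral theorem reduces the bound to the eigenvalues of [K]; an
   eigenvector can be chosen to be an eigenvector of the symmetries [p] and [q]. *)
Lemma symmetric_kernel_bound K (p q : T -> T) (z c : C) : 0 <= c ->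
  (forall s t, K s t \is Num.real) -> (forall s t, K s t = K t s) ->
  bijective p -> bijective q -> p \o q =1 q \o p ->
  (forall s t, K (p s) (p t) = K s t) -> (forall s t, K (q s) (q t) = K s t) ->
  (forall d f a b, (exists t, f t != 0) -> d \is Num.real ->
     (forall t, \sum_s f s * K s t = d * f t) ->
     (forall t, f (p t) = a * f t) -> (forall t, f (q t) = b * f t) ->
     c <= `|d - z|) ->
  forall f, c ^+ 2 * \sum_t `|f t| ^+ 2 <=
    \sum_t `|\sum_s f s * K s t - z * f t| ^+ 2.
Proof.
move=> c0 Kr Ks pb qb pq Kp Kq H f.
set A := kernel_mx K.
have Aherm : A \is hermsymmx.
  apply: realsym_hermsym; last by apply/mxOverP => i j; rewrite mxE.
  by apply/is_hermitianmxP; rewrite expr0 scale1r map_mx_id//;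
    apply/matrixP => i j; rewrite !mxE Ks.
have /orthomx_spectralP AP := hermitian_normalmx Aherm.
set P := spectralmx A in AP; set d := spectral_diag A in AP.
have PU : P \is unitarymx := spectral_unitarymx A.
have Pu : P \in unitmx := spectral_unit A.
have dr i : d 0 i \is Num.real.
  by have /mxOverP := hermitian_spectral_diag_real Aherm; apply.
have commp (r : T -> T) : bijective r -> (forall s t, K (r s) (r t) = K s t) ->
    comm_mx A (kernel_mx (perm_kernel r)).
  move=> rb Kr'; apply: eq_mx_fun_row => g.
  rewrite !mulmxA /A (fun_row_kernel K g) !fun_row_perm (fun_row_kernel K).
  apply/rowP => i; rewrite !mxE /= (reindex r) /=; last exact: onW_bij.
  by apply: eq_bigr => s _; rewrite Kr'.
(* Row [i] of [P] shows [d 0 i] to be an eigenvalue; its eigenspace contains a joint eigenvector of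
   both symmetries, to which [H] applies. *)
have dbound i : c <= `|d 0 i - z|.
  have ev : eigenvalue A (d 0 i).
    apply/eigenvalueP; exists (row i P); last first.
      apply/eqP => P0; move: (row_unitarymxP PU i i).
      by rewrite P0 dotmxE mul0mx mxE eqxx => /eqP; rewrite eq_sym oner_eq0.
    rewrite {1}AP !mulmxA -row_mul mulmxV// row1 -rowE row_diag_mx -scalemxAl.
    by rewrite -rowE.
  have [|||v [v0 vA vB]] := common_eigenvector_at _ A (d 0 i)
    [:: kernel_mx (perm_kernel p); kernel_mx (perm_kernel q)].
  - exact: ev.
  - by move=> B; rewrite !inE => /orP[]/eqP ->; exact: commp.
  - have pqc : comm_mx (kernel_mx (perm_kernel p)) (kernel_mx (perm_kernel q)).
      apply: eq_mx_fun_row => g; rewrite !mulmxA !fun_row_perm.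
      by congr fun_row; apply/funext => t /=; rewrite -[p (q t)]/((p \o q) t) pq.
    by move=> B B'; rewrite !inE => /orP[]/eqP -> /orP[]/eqP ->;
      rewrite /comm_mx// pqc.
  have [g vg] := fun_row_surj v.
  have [a] := vB _ (mem_head _ _);
    rewrite vg fun_row_perm fun_rowZ => /fun_row_eq pa.
  have /vB[b] : kernel_mx (perm_kernel q) \in
      [:: kernel_mx (perm_kernel p); kernel_mx (perm_kernel q)].
    by rewrite !inE eqxx orbT.
  rewrite vg fun_row_perm fun_rowZ => /fun_row_eq qb'.
  apply: (H (d 0 i) g a b) => //.
    apply: contrapT => g0; move/eqP: v0; apply; rewrite vg; apply/rowP => j.
    rewrite !mxE; apply/eqP; apply: contrapT => gj; apply: g0.
    by exists (enum_val j); apply/negP.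
  by apply: fun_row_eq; rewrite -fun_row_kernel -fun_rowZ -vg.
have e g : \sum_t `|g t| ^+ 2 = \sum_i `|fun_row g 0 i| ^+ 2.
  rewrite [LHS](reindex _ (onW_bij _ (@enum_val_bij T))) /=.
  by apply: eq_bigr => i _; rewrite mxE.
rewrite !e.
(* In the spectral coordinates [y] the operator is diagonal, and the unitary [P] preserves sums of
   squares, so the bound is checked entry by entry. *)
set w := fun_row f; pose y := w *m invmx P.
have -> : fun_row (fun t => \sum_s f s * K s t - z * f t) =
    (y *m diag_mx d - z *: y) *m P.
  rewrite mulmxBl -scalemxAl /y mulmxKV// -!mulmxA (mulmxA (invmx P)) -AP.
  by rewrite fun_row_kernel; apply/rowP => i; rewrite !mxE.
have -> : w = y *m P by rewrite /y mulmxKV.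
rewrite !(sqnorm_unitary _ P _ PU) mulr_sumr; apply: ler_sum => i _.
rewrite mul_mx_diag !mxE (mulrC _ (d 0 i)) -mulrBl normrM exprMn.
by rewrite ler_wpM2r ?exprn_ge0// lerXn2r ?nnegrE.
Qed.

End finite_kernel.

(** * Quasi-periodic functions *)

Lemma odd_absz_add1 (n : int) : odd `|(n + 1)%R| = ~~ odd `|n|.
Proof. lia. Qed.

Lemma potential_parity (R : realType) (n m : int) :
  potential R (n, m) = if odd `|n| && odd `|m| then -1 else 1.
Proof.
rewrite /potential -oddM -abszM (mulrC m).
case: (n * m) => k /=; first by rewrite -[LHS]signr_odd; case: odd.
by rewrite -[LHS]/(((-1) ^+ k.+1)^-1) -exprVn invrN1 -signr_odd /=; case: odd.
Qed.

Lemma periodic2_parity {T : Type} (f : int -> T) (n : int) :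
  (forall k, f (k + 2) = f k) -> f n = f (odd `|n| : nat).
Proof.
move=> fp; have up (j : nat) k : f (k + (j * 2)%N%:Z) = f k.
  elim: j => [|j IH]; first by rewrite addr0.
  by rewrite mulSnr PoszD addrA fp IH.
have [n0|n0] := leP 0 n.
  by rewrite -[LHS](up 0%N) -[RHS](up (`|n|%N)./2); congr f; lia.
by rewrite -[LHS](up (uphalf `|n|)); congr f; lia.
Qed.

Section gauge.
Context {R : realType}.
Variables (z w : R[i]) (phi : Z2 -> R[i]).
Hypotheses (z0 : z != 0) (w0 : w != 0).
Hypothesis phi1 : forall x, phi (x + (2, 0)) = phi x.
Hypothesis phi2 : forall x, phi (x + (0, 2)) = phi x.

(** Periodicity [2] identifies the values of [phi] at opposite neighbours, so the six terms collapse
    into three with paired phases. *)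
Lemma gauge_sum_nbrs (n m : int) :
  \sum_(e <- nbrs) (z ^ ((n, m) + e).1 * w ^ ((n, m) + e).2 * phi ((n, m) + e)) =
  z ^ n * w ^ m * ((z + z^-1) * phi (n + 1, m) + (w + w^-1) * phi (n, m + 1)
    + (z * w^-1 + z^-1 * w) * phi (n + 1, m + 1)).
Proof.
have p1 : phi (n - 1, m) = phi (n + 1, m).
  by rewrite -(phi1 (n - 1, m)); congr phi; congr pair => /=; ring.
have p2 : phi (n, m - 1) = phi (n, m + 1).
  by rewrite -(phi2 (n, m - 1)); congr phi; congr pair => /=; ring.
have p3 : phi (n - 1, m + 1) = phi (n + 1, m + 1).
  by rewrite -(phi1 (n - 1, m + 1)); congr phi; congr pair => /=; ring.
have p4 : phi (n + 1, m - 1) = phi (n + 1, m + 1).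
  by rewrite -(phi2 (n + 1, m - 1)); congr phi; congr pair => /=; ring.
have e (a b : int) : (n, m) + (a, b) = (n + a, m + b) :> Z2 by [].
rewrite /nbrs !big_cons big_nil !e /= !addr0 p1 p2 p3 p4.
rewrite !expfzDr// !expr1z -!invr_expz !expr1z; ring.
Qed.

End gauge.

Lemma unit_angle {R : realType} (z : R[i]) : `|z| = 1 ->
  exists x : R, z = (cos x +i* sin x)%C.
Proof.
case: z => a b /(congr1 (fun u => u ^+ 2)).
rewrite -add_Re2_Im2 expr1n /= -[1]/(1%:C) => /complexI ab.
have a1 : -1 <= a <= 1.
  have : a ^+ 2 <= 1 by rewrite -ab lerDl sqr_ge0.
  by rewrite -ler_norml -real_normK ?num_real// expr_le1.
have ca : cos (acos a) = a by rewrite acosK.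
have sa : sin (acos a) ^+ 2 = b ^+ 2 by rewrite sin2cos2 ca -ab addrC addKr.
move/eqP: sa; rewrite eqf_sqr => /orP[/eqP sb|/eqP sb].
  by exists (acos a); rewrite ca sb.
by exists (- acos a); rewrite cosN sinN ca sb opprK.
Qed.

Lemma angle_inv {R : realType} (x : R) :
  ((cos x +i* sin x)%C)^-1 = (cos x +i* - sin x)%C.
Proof.
have h : (cos x +i* sin x)%C * (cos x +i* - sin x)%C = 1.
  rewrite -[LHS]/(mulc _ _) /mulc mulrN opprK -!expr2 cos2Dsin2.
  by rewrite mulrN (mulrC (cos x)) addNr.
by apply: (mulfI (x := (cos x +i* sin x)%C)); rewrite ?h ?divff//;
  apply/eqP => h0; move/eqP: h; rewrite h0 mul0r eq_sym oner_eq0.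
Qed.

Section angles.
Context {R : realType} (x y : R).
Let z : R[i] := (cos x +i* sin x)%C.
Let w : R[i] := (cos y +i* sin y)%C.

Lemma angle_neq0 : z != 0.
Proof.
apply/eqP => -[c0 s0]; have := cos2Dsin2 x.
by rewrite c0 s0 expr0n addr0 => /eqP; rewrite eq_sym oner_eq0.
Qed.

Lemma angle_sum : z + z^-1 = (2 * cos x)%:C.
Proof.
rewrite angle_inv; apply/eqP; rewrite eq_complex /= subrr eqxx andbT.
by apply/eqP; ring.
Qed.

Lemma angle_diff : z * w^-1 + z^-1 * w = (2 * cos (x - y))%:C.
Proof.
rewrite !angle_inv cosB; apply/eqP; rewrite eq_complex /=.
by apply/andP; split; apply/eqP; ring.
Qed.

Lemma sqmod_angle_exp (n : int) : sqmod (z ^ n) = 1.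
Proof.
have h u : sqmod u = 1 -> forall k : nat, sqmod (u ^+ k) = 1 :> R.
  move=> u1; elim=> [|k IH]; first by rewrite expr0 /sqmod /= expr0n addr0 expr1n.
  by rewrite exprS sqmodM u1 mul1r.
case: n => k; first by apply: h; rewrite /sqmod /= cos2Dsin2.
by rewrite NegzE -invr_expz -exprVn; apply: h;
  rewrite angle_inv /sqmod /= sqrrN cos2Dsin2.
Qed.

End angles.

Lemma fibre_det_complex {R : realType} (l u a b c : R) :
  fibre_det l%:C u%:C a%:C b%:C c%:C = (fibre_det l u a b c)%:C.
Proof. by rewrite /fibre_det !(rmorphB, rmorphD, rmorphM, rmorphXn,
  rmorph_nat). Qed.

Lemma cos_relC {R : realType} (x y : R) :
  (2 * cos x)%:C ^+ 2 + (2 * cos y)%:C ^+ 2 + (2 * cos (x - y))%:C ^+ 2 =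
  4 + (2 * cos x)%:C * (2 * cos y)%:C * (2 * cos (x - y))%:C :> R[i].
Proof.
rewrite -!rmorphXn -!rmorphM -!rmorphD cos_rel.
by rewrite rmorphD rmorph_nat.
Qed.

(** The multipliers belong to steps of length two, so their square roots [z], [w] are the Bloch
    phases. Dividing by [z ^ n * w ^ m] leaves a 2-periodic function whose four values are a nonzero
    null vector of the fibre. *)
Lemma quasiperiodic_bloch {R : realType} (l E : R) (psi : Z2 -> R[i]) (a b : R[i]) :
  (exists x, psi x != 0) -> (forall x, Htri l psi x = E%:C * psi x) ->
  (forall x, psi (x + (2, 0)) = a * psi x) ->
  (forall x, psi (x + (0, 2)) = b * psi x) -> `|a| = 1 -> `|b| = 1 ->
  bloch_spectrum l E.
Proof.
move=> [x0 psi0] psiE psia psib a1 b1.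
have root (u : R[i]) : `|u| = 1 -> exists2 v : R[i], `|v| = 1 & v ^+ 2 = u.
  move=> u1; exists (sqrtC u); last exact: sqrtCK.
  by apply/eqP; rewrite -(@pexpr_eq1 _ _ 2)// -normrX sqrtCK u1.
have [z /unit_angle[x zx] za] := root _ a1.
have [w /unit_angle[y wy] wb] := root _ b1.
have z0 : z != 0 by rewrite zx angle_neq0.
have w0 : w != 0 by rewrite wy angle_neq0.
pose phi (p : Z2) := z ^ (- p.1) * w ^ (- p.2) * psi p.
have psiphi p : psi p = z ^ p.1 * w ^ p.2 * phi p.
  rewrite /phi !mulrA -(mulrA (z ^ _)) (mulrC (w ^ _)) mulrA -!expfzDr//.
  by rewrite subrr mul1r -mulrA mulrA -expfzDr// subrr mul1r.
have phi1 p : phi (p + (2, 0)) = phi p.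
  rewrite /phi psia -za /= addr0 opprD expfzDr//.
  by rewrite -[z ^ (- 2)]/((z ^+ 2)^-1); field.
have phi2 p : phi (p + (0, 2)) = phi p.
  rewrite /phi psib -wb /= addr0 opprD expfzDr//.
  by rewrite -[w ^ (- 2)]/((w ^+ 2)^-1); field.
have eqn (n m : int) : (E%:C - (l * potential R (n, m))%:C) * phi (n, m) =
    (2 * cos x)%:C * phi (n + 1, m) + (2 * cos y)%:C * phi (n, m + 1)
    + (2 * cos (x - y))%:C * phi (n + 1, m + 1).
  have := psiE (n, m); rewrite HtriE.
  under eq_bigr do rewrite psiphi.
  rewrite gauge_sum_nbrs// psiphi /= zx wy !angle_sum angle_diff -zx -wy => h.
  have zw : z ^ n * w ^ m != 0 by rewrite mulf_neq0// expfz_neq0.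
  apply: (mulfI zw); rewrite mulrBl mulrBr.
  by rewrite (mulrCA _ E%:C) -h (mulrCA _ (l * _)%:C) addrK.
have P1 m : phi (1 + 1, m) = phi (0, m).
  by rewrite -(phi1 (0, m)); congr phi; congr pair => /=; rewrite addr0.
have P2 n : phi (n, 1 + 1) = phi (n, 0).
  by rewrite -(phi2 (n, 0)); congr phi; congr pair => /=; rewrite addr0.
exists x, y; apply: (@complexI R); rewrite /torus_det -fibre_det_complex rmorphB.
apply: (fibre_kernel_det _ _ _ _ _ (cos_relC x y) (phi (0, 0)) (phi (1, 0))
  (phi (0, 1)) (phi (1, 1))).
  have := eqn 0 0; have := eqn 1 0; have := eqn 0 1; have := eqn 1 1.
  rewrite !potential_parity /= !mulr1 !mulrN1 !add0r !P1 !P2.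
  rewrite rmorphN opprK => h3 h2 h1 h0; split => //.
  - by rewrite h1; ring.
  - by rewrite h2; ring.
  - by rewrite h3; ring.
move=> [v0 v1 v2 v3]; move/eqP: psi0; apply; rewrite psiphi.
suff -> : phi x0 = 0 by rewrite mulr0.
case: x0 => n m.
rewrite (periodic2_parity (fun n => phi (n, m))); last first.
  by move=> k; rewrite -(phi1 (k, m)); congr phi; congr pair => /=; rewrite addr0.
rewrite (periodic2_parity (fun m => phi (_, m))); last first.
  by move=> k; rewrite -(phi2 (_, k)); congr phi; congr pair => /=; rewrite addr0.
by case: odd; case: odd.
Qed.

Lemma bloch_sub_spectrum {R : realType} (l E : R) :
  bloch_spectrum l E -> spectrum (Htri l) E%:C.
Proof.
move=> [x [y /(fibre_det_kernel _ _ _ _ _ (cos_rel x y))]].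
move=> [v0 [v1 [v2 [v3 [[h0 h1 h2 h3] vn]]]]].
(* The real null vector is extended with period [2]; multiplied by a plane wave it becomes a bounded
   solution. *)
pose phi (p : Z2) : R := if odd `|p.1| then (if odd `|p.2| then v3 else v1)
  else (if odd `|p.2| then v2 else v0).
pose z : R[i] := (cos x +i* sin x)%C; pose w : R[i] := (cos y +i* sin y)%C.
have z0 : z != 0 := angle_neq0 x. have w0 : w != 0 := angle_neq0 y.
pose psi (p : Z2) := z ^ p.1 * w ^ p.2 * (phi p)%:C.
apply: (bounded_solution_spectrum l E (v0 ^+ 2 + v1 ^+ 2 + v2 ^+ 2 + v3 ^+ 2) psi).
- move=> p; have zw1 : sqmod (z ^ p.1 * w ^ p.2) = 1.
    move: (sqmod_angle_exp x p.1) (sqmod_angle_exp y p.2).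
    by rewrite -/z -/w; move: (z ^ _) (w ^ _) => Z W hZ hW;
      rewrite sqmodM hZ hW mul1r.
  rewrite /psi sqmodM zw1 mul1r sqmod_real.
  have := sqr_ge0 v0; have := sqr_ge0 v1; have := sqr_ge0 v2; have := sqr_ge0 v3.
  by rewrite /phi; case: odd; case: odd; lra.
- move=> [n m]; rewrite HtriE potential_parity /psi.
  rewrite (gauge_sum_nbrs z w (fun p => (phi p)%:C))//.
  + rewrite angle_sum (angle_sum y)
    angle_diff /= [in RHS]mulrCA [_%:C * (_ * _)]mulrCA -mulrDr.
    congr (_ * _); rewrite -!rmorphM -!rmorphD; congr (_%:C).
    rewrite /phi /= !odd_absz_add1.
    case: (odd `|n|) => /=; case: (odd `|m|) => /=; lra.
  + by move=> [i j]; rewrite /phi /= addr0 (_ : odd `|i + 2| = odd `|i|)//; lia.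
  + by move=> [i j]; rewrite /phi /= addr0 (_ : odd `|j + 2| = odd `|j|)//; lia.
have nz p : phi p <> 0 -> exists p, psi p <> 0.
  move=> p0; exists p; apply/eqP; rewrite mulf_neq0 ?mulf_neq0 ?expfz_neq0//.
  by apply/eqP => -[].
have [v00|/(nz (0, 0))//] := pselect (v0 = 0).
have [v10|/(nz (1, 0))//] := pselect (v1 = 0).
have [v20|/(nz (0, 1))//] := pselect (v2 = 0).
have [v30|/(nz (1, 1))//] := pselect (v3 = 0).
by exfalso; apply: vn.
Qed.

(** * Finite tori *)

Section torus.
Context {R : realType} (l : R) (L : nat).

Local Notation torus := ('Z_(L.*2.+2) * 'Z_(L.*2.+2))%type.

Definition torus_proj (x : Z2) : torus := (x.1%:~R, x.2%:~R).

(** The side [2 * L + 2] is even, so parity and the potential descend to the torus. Representatives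
    run from [- (L + 1)] to [L], so the box of radius [L] is recovered exactly. *)
Definition Zp_rep (i : 'Z_(L.*2.+2)) : int :=
  if (i <= L)%N then i%:Z else i%:Z - (L.*2.+2)%:Z.

Definition torus_rep (t : torus) : Z2 := (Zp_rep t.1, Zp_rep t.2).

Lemma Zp_repK (i : 'Z_(L.*2.+2)) : (Zp_rep i)%:~R = i.
Proof.
have nat_i : (i : nat)%:Z%:~R = i by rewrite -[LHS]/((i : nat)%:R) natr_Zp.
rewrite /Zp_rep; case: ifP => // _.
by rewrite rmorphB /= nat_i -[X in _ - X]/((L.*2.+2)%:R) pchar_Zp// subr0.
Qed.

Lemma torus_repK t : torus_proj (torus_rep t) = t.
Proof. by case: t => i j; rewrite /torus_proj /= !Zp_repK. Qed.

Lemma torus_projD x y : torus_proj (x + y) = torus_proj x + torus_proj y.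
Proof. by rewrite /torus_proj !rmorphD. Qed.

Lemma Zp_rep_intr (n : int) : (`|n| <= L)%N -> Zp_rep n%:~R = n.
Proof.
case: n => k kL; rewrite /Zp_rep.
  rewrite -[k%:~R]/(k%:R) val_Zp_nat// modn_small; last lia.
  by rewrite kL.
have -> : (Negz k)%:~R = (L.*2.+2 - k.+1)%:R :> 'Z_(L.*2.+2).
  rewrite natrB; last lia.
  by rewrite pchar_Zp// sub0r NegzE rmorphN.
rewrite val_Zp_nat// modn_small; last lia.
by rewrite ifF; lia.
Qed.

Lemma torus_rep_proj x : (`|x.1| <= L)%N -> (`|x.2| <= L)%N ->
  torus_rep (torus_proj x) = x.
Proof. by case: x => n m /= nL mL; rewrite /torus_rep /= !Zp_rep_intr. Qed.

Lemma Zp_rep_parity (n : int) : odd `|Zp_rep n%:~R| = odd `|n|.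
Proof.
pose d : int := Zp_rep n%:~R - n.
have d0 : (`|d|%N)%:R = 0 :> 'Z_(L.*2.+2).
  have dz : d%:~R = 0 :> 'Z_(L.*2.+2) by rewrite rmorphB /= Zp_repK subrr.
  case: d dz => k; first by [].
  by rewrite NegzE rmorphN => /eqP; rewrite oppr_eq0 => /eqP.
have : (L.*2.+2 %| `|d|)%N.
  by rewrite /dvdn -(val_Zp_nat (isT : 1 < L.*2.+2)%N) d0.
have even_period : (2 %| L.*2.+2)%N by rewrite dvdn2 /= negbK odd_double.
by move=> /(dvdn_trans even_period); rewrite dvdn2 /d; lia.
Qed.

Lemma potential_torus x : potential R (torus_rep (torus_proj x)) = potential R x.
Proof. by case: x => n m; rewrite !potential_parity !Zp_rep_parity. Qed.

Lemma torus_rep_inj : injective torus_rep.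
Proof. exact: can_inj torus_repK. Qed.

Definition torus_op (f : torus -> R[i]) (t : torus) : R[i] :=
  \sum_(e <- nbrs) f (t + torus_proj e)
  + (l * potential R (torus_rep t))%:C * f t.

Lemma Htri_torus (f : torus -> R[i]) x :
  Htri l (f \o torus_proj) x = torus_op f (torus_proj x).
Proof.
rewrite HtriE /torus_op potential_torus; congr (_ + _).
by apply: eq_bigr => e _ /=; rewrite torus_projD.
Qed.

(** Summing indicators counts neighbours that coincide on a very small torus with multiplicity, as
    [torus_op] does. *)
Definition torus_kernel (s t : torus) : R[i] :=
  \sum_(e <- nbrs) (s == t + torus_proj e)%:R
  + (s == t)%:R * (l * potential R (torus_rep t))%:C.

Lemma torus_kernelE f t : \sum_s f s * torus_kernel s t = torus_op f t.
Proof.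
have delta u (a : R[i]) : \sum_s f s * ((s == u)%:R * a) = f u * a.
  by rewrite (bigD1 u)//= eqxx mul1r big1 ?addr0// => s /negPf ->;
    rewrite mul0r mulr0.
under eq_bigr do rewrite mulrDr mulr_sumr.
rewrite big_split /= exchange_big /= delta mulrC; congr (_ + _).
by apply: eq_bigr => e _; rewrite -[RHS]mulr1 -delta;
  apply: eq_bigr => s _; rewrite mulr1.
Qed.

Lemma torus_kernel_sym s t : torus_kernel s t = torus_kernel t s.
Proof.
rewrite /torus_kernel; congr (_ + _); last first.
  by rewrite eq_sym; case: eqP => [->|_]//; rewrite !mul0r.
have pn : perm_eq nbrs [seq - e | e <- nbrs] by [].
rewrite [RHS](perm_big _ pn) big_map; apply: eq_bigr => e _.
have -> : torus_proj (- e) = - torus_proj e by rewrite /torus_proj !rmorphN.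
by rewrite [in RHS]eq_sym subr_eq.
Qed.

Lemma torus_kernel_shift (a : Z2) s t : ~~ odd `|a.1| -> ~~ odd `|a.2| ->
  torus_kernel (s + torus_proj a) (t + torus_proj a) = torus_kernel s t.
Proof.
move=> a1 a2; rewrite /torus_kernel; congr (_ + _).
  by apply: eq_bigr => e _; rewrite addrAC (inj_eq (addIr _)).
rewrite (inj_eq (addIr _)); congr (_ * (_ * _)%:C).
rewrite -{1}(torus_repK t) -torus_projD potential_torus.
case: (torus_rep t) a a1 a2 => n m [i j] /= ie je.
rewrite -[LHS]/(potential R (n + i, m + j)) -[RHS]/(potential R (n, m)).
rewrite !potential_parity.
have -> : odd `|n + i| = odd `|n| by lia.
by have -> : odd `|m + j| = odd `|m| by lia.
Qed.

Lemma Zp_mulr_period (i : 'Z_(L.*2.+2)) : i *+ L.*2.+2 = 0.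
Proof.
have M0 : (L.*2.+2)%:R = 0 :> 'Z_(L.*2.+2) by apply: pchar_Zp.
by rewrite -[LHS]mulr_natr M0 mulr0.
Qed.

(** Translations of the torus have finite order, so the multiplier is a root of unity. *)
Lemma torus_phase (f : torus -> R[i]) (u : torus) (a : R[i]) t :
  (forall t, f (t + u) = a * f t) -> f t != 0 -> `|a| = 1.
Proof.
move=> fa ft.
have fak k s : f (s + u *+ k) = a ^+ k * f s.
  elim: k => [|k IH]; first by rewrite mulr0n addr0 mul1r.
  by rewrite mulrSr addrA fa IH exprS mulrA.
have u0 : u *+ L.*2.+2 = 0.
  case: u {fa fak} => i j.
  have e k : (i, j) *+ k = (i *+ k, j *+ k) :> torus.
    by elim: k => // k IH; rewrite !mulrS IH.
  by rewrite e !Zp_mulr_period.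
have := fak L.*2.+2 t; rewrite u0 addr0 -[LHS]mul1r => /(mulIf ft) a1.
by apply/eqP; rewrite -(@pexpr_eq1 _ _ L.*2.+2)// -normrX -a1 normr1.
Qed.

Section bound.
Context (z : R[i]) (c : R).
Hypothesis zc : forall E, bloch_spectrum l E -> c%:C <= `|E%:C - z|.

(** The symmetries are the translations by [(2, 0)] and [(0, 2)]. A joint eigenfunction lifts to a
    quasi-periodic function on the lattice, so its eigenvalue is a Bloch energy; the bound does not
    depend on [L]. *)
Lemma torus_bound f : 0 <= c -> c ^+ 2 * \sum_t sqmod (f t) <=
  \sum_t sqmod (torus_op f t - z * f t).
Proof.
move=> c0; rewrite -lecR rmorphM rmorphXn !rmorph_sum /=.
have sq (w : R[i]) : (sqmod w)%:C = `|w| ^+ 2 by rewrite add_Re2_Im2.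
under eq_bigr do rewrite sq.
under [leRHS]eq_bigr do rewrite sq -torus_kernelE.
pose p (a : Z2) (t : torus) := t + torus_proj a.
have pb a : bijective (p a) by exists (fun t => t - torus_proj a) => t;
  rewrite /p ?addrK ?subrK.
apply: (symmetric_kernel_bound torus_kernel (p (2, 0)) (p (0, 2))).
- by rewrite ler0c.
- move=> s t; rewrite rpredD// ?rpred_sum// => [e _|]; first exact: realn.
  by rewrite rpredM ?realn// complex_real.
- exact: torus_kernel_sym.
- exact: pb.
- exact: pb.
- by move=> t; rewrite /p /= addrAC.
- by move=> s t; apply: torus_kernel_shift.
- by move=> s t; apply: torus_kernel_shift.
move=> d g a b [t gt] /complex_realP[E ->] gE ga gb; apply: zc.
apply: (quasiperiodic_bloch l E (g \o torus_proj) a b).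
- by exists (torus_rep t); rewrite /= torus_repK.
- by move=> x; rewrite Htri_torus -torus_kernelE gE.
- by move=> x /=; rewrite torus_projD ga.
- by move=> x /=; rewrite torus_projD gb.
- exact: (torus_phase g _ a t ga gt).
- exact: (torus_phase g _ b t gb gt).
Qed.

(** In finite dimension the lower bound of [torus_bound] gives injectivity, hence invertibility. *)
Lemma torus_solve g : 0 < c -> exists f, forall t, torus_op f t - z * f t = g t.
Proof.
move=> c0.
pose K s t := torus_kernel s t - z * (s == t)%:R.
have KE f t : \sum_s f s * K s t = torus_op f t - z * f t.
  rewrite -torus_kernelE; under eq_bigr do rewrite mulrBr.
  rewrite sumrB; congr (_ - _).
  rewrite (bigD1 t)//= eqxx mulr1 mulrC big1 ?addr0// => s /negPf ->.
  by rewrite !mulr0.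
have Kfree : row_free (kernel_mx K).
  apply: inj_row_free => v; have [f ->] := fun_row_surj v.
  rewrite fun_row_kernel => K0.
  have f0 t : \sum_s f s * K s t = 0.
    by have /rowP/(_ (enum_rank t)) := K0; rewrite !mxE enum_rankK.
  have := torus_bound f (ltW c0).
  rewrite [leRHS]big1 => [|t _]; last by rewrite -KE f0 sqmod0.
  rewrite pmulr_rle0 ?exprn_gt0// => s0.
  apply/rowP => i; rewrite !mxE; apply: sqmod_eq0; apply/eqP.
  rewrite eq_le sqmod_ge0 andbT (le_trans _ s0)//.
  by rewrite (bigD1 (enum_val i))//= lerDl sumr_ge0// => t _; exact: sqmod_ge0.
have Ku : kernel_mx K \in unitmx by rewrite -row_free_unit.
have [f fE] := fun_row_surj (fun_row g *m invmx (kernel_mx K)).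
exists f => t; rewrite -KE.
apply: (@fun_row_eq _ _ (fun t => \sum_s f s * K s t)).
by rewrite -fun_row_kernel -fE mulmxKV.
Qed.

End bound.

End torus.

(** * Resolvent *)

(** Compactness of [[- B, B]] provides a cluster point, and an ultrafilter converges to each of its
    cluster points. *)
Lemma ultra_bounded_cvg {R : realType} {T : Type} (U : set_system T) (u : T -> R)
    (B : R) : UltraFilter U -> (forall n, `|u n| <= B) ->
  exists a : R, u @ U --> a.
Proof.
move=> UU uB.
have FU : ProperFilter (u @ U) by apply: fmap_proper_filter.
have uI : U (u @^-1` `[- B, B]%classic).
  by apply: filterE => n; rewrite /= in_itv /= -ler_norml uB.
have [a [_ acl]] := @segment_compact R (- B) B (u @ U) FU uI.
exists a => V aV; have [//|nV] := in_ultra_setVsetC (u @^-1` V) UU.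
by have [y [/=]] := acl (~` V) V nV aV.
Qed.

Section cvg_parts.
Context {R : realType} {T : Type} (U : set_system T) {FU : ProperFilter U}.

(** Separate real and imaginary parts let compactness and uniqueness of limits be taken in [R]. *)
Definition cvg_parts (u : T -> R[i]) (a : R[i]) : Prop :=
  (fun n => complex.Re (u n)) @ U --> complex.Re a /\
  (fun n => complex.Im (u n)) @ U --> complex.Im a.

Lemma cvg_partsD u v a b : cvg_parts u a -> cvg_parts v b ->
  cvg_parts (fun n => u n + v n) (a + b).
Proof.
move=> [ua ua'] [vb vb']; split; rewrite raddfD /=.
  by under eq_fun do rewrite raddfD /=; exact: cvgD.
by under eq_fun do rewrite raddfD /=; exact: cvgD.
Qed.

Lemma cvg_partsZ k u a : cvg_parts u a -> cvg_parts (fun n => k * u n) (k * a).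
Proof.
have Re_mul (x y : R[i]) : complex.Re (x * y) =
  complex.Re x * complex.Re y - complex.Im x * complex.Im y by case: x; case: y.
have Im_mul (x y : R[i]) : complex.Im (x * y) =
  complex.Re x * complex.Im y + complex.Im x * complex.Re y by case: x; case: y.
move=> [ua ua']; split; rewrite ?Re_mul ?Im_mul.
  by under eq_fun do rewrite Re_mul; apply: cvgB; apply: cvgMr.
by under eq_fun do rewrite Im_mul; apply: cvgD; apply: cvgMr.
Qed.

Lemma cvg_parts_sum {I : Type} (s : seq I) (u : I -> T -> R[i]) (a : I -> R[i]) :
  (forall i, cvg_parts (u i) (a i)) ->
  cvg_parts (fun n => \sum_(i <- s) u i n) (\sum_(i <- s) a i).
Proof.
move=> h; elim: s => [|i s IH].
  by rewrite big_nil; under eq_fun do rewrite big_nil; split; exact: cvg_cst.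
by rewrite big_cons; under eq_fun do rewrite big_cons; exact: cvg_partsD.
Qed.

Lemma cvg_parts_near_cst u a b : cvg_parts u a -> (\forall n \near U, u n = b)
  -> a = b.
Proof.
move=> [ua ua'] ub; apply/eqP; rewrite eq_complex; apply/andP; split; apply/eqP.
  apply: (@cvg_unique _ (@Rhausdorff R) _ _ _ _ ua).
  by apply: cvg_near_cst; apply: filterS ub => n ->.
apply: (@cvg_unique _ (@Rhausdorff R) _ _ _ _ ua').
by apply: cvg_near_cst; apply: filterS ub => n ->.
Qed.

Lemma cvg_sum_sqmod {I : Type} (s : seq I) (u : I -> T -> R[i]) (a : I -> R[i]) :
  (forall i, cvg_parts (u i) (a i)) ->
  \sum_(i <- s) sqmod (u i n) @[n --> U] --> \sum_(i <- s) sqmod (a i).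
Proof.
move=> h; elim: s => [|i s IH].
  by rewrite big_nil; under eq_fun do rewrite big_nil; exact: cvg_cst.
rewrite big_cons; under eq_fun do rewrite big_cons; apply: cvgD => //.
have [ha ha'] := h i; rewrite /sqmod !expr2; under eq_fun do rewrite !expr2.
by apply: cvgD; apply: cvgM.
Qed.

End cvg_parts.

Lemma seq_box (s : seq Z2) :
  exists N, forall x, x \in s -> (`|x.1| <= N)%N /\ (`|x.2| <= N)%N.
Proof.
elim: s => [|x s [N IH]]; first by exists 0%N.
exists (maxn N (maxn `|x.1| `|x.2|)) => y; rewrite !leq_max.
by move=> /predU1P[->|/IH[-> ->]]; rewrite ?leqnn ?orbT.
Qed.

Lemma absz_add_nbr (x e : Z2) (N : nat) : e \in 0 :: nbrs ->
  (`|x.1| <= N)%N -> (`|x.2| <= N)%N ->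
  (`|(x + e)%R.1| <= N.+1)%N /\ (`|(x + e)%R.2| <= N.+1)%N.
Proof.
case: x => n m he /= nN mN.
have [e1 e2] : (`|e.1| <= 1)%N /\ (`|e.2| <= 1)%N.
  by move: he; rewrite /nbrs !inE; do 6?[case/predU1P => [->//|]]; move=> /eqP ->.
by move: e {he} e1 e2 => [i j] /= *; split; lia.
Qed.

Section resolvent.
Context {R : realType} (l : R) (z : R[i]) (c : R).
Hypothesis c0 : 0 < c.
Hypothesis zc : forall E, bloch_spectrum l E -> c%:C <= `|E%:C - z|.

Local Notation shift := (shift_by (Htri l) z).

(* The equation is solved on larger and larger tori with uniform bounds; a
   pointwise limit of the periodic solutions along an ultrafilter solves it on
   the whole lattice. *)
Lemma shift_by_solution g : ell2 g ->
  exists f, mass_le f ((c ^+ 2)^-1 * norm2 g ^+ 2) /\ shift f = g.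
Proof.
move=> g2; set C := (c ^+ 2)^-1 * _.
pose F L := sval (cid (torus_solve l L z c zc (g \o torus_rep L) c0)).
have FE L t : torus_op l L (F L) t - z * F L t = g (torus_rep L t).
  by rewrite /F; case: cid.
(* Distinct torus points have distinct representatives, so the right-hand side on the torus has no
   more mass than [g]. *)
have FC L : \sum_t sqmod (F L t) <= C.
  rewrite ler_pdivlMl ?exprn_gt0// (le_trans (torus_bound l L z c zc _ (ltW c0)))//.
  under eq_bigr do rewrite FE.
  rewrite -big_enum -(big_map _ xpredT (fun x => sqmod (g x))).
  by apply: (ell2_mass_le _ g2); rewrite map_inj_uniq ?enum_uniq//;
    exact: torus_rep_inj.
pose f L x := F L (torus_proj L x).
have fE L x : (`|x.1| <= L)%N -> (`|x.2| <= L)%N -> shift (f L) x = g x.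
  move=> x1 x2; rewrite -[in RHS](torus_rep_proj L x)// -FE /shift_by.
  by rewrite -Htri_torus.
have fC L x : sqmod (f L x) <= C.
  rewrite (le_trans _ (FC L))// (bigD1 (torus_proj L x))//= lerDl.
  by rewrite sumr_ge0// => t _; exact: sqmod_ge0.
have C0 : 0 <= C := le_trans (sqmod_ge0 _) (fC 0%N 0).
have fB L x : `|complex.Re (f L x)| <= C + 1 /\ `|complex.Im (f L x)| <= C + 1.
  (* [C + 1] replaces the square root of [C], since [C <= (C + 1) ^ 2]. *)
  have sqB (a b : R) : a ^+ 2 + b ^+ 2 <= C -> `|a| <= C + 1.
    move=> abC; rewrite -(@ler_pXn2r _ 2)// ?nnegrE//; last by rewrite addr_ge0.
    rewrite real_normK ?num_real// sqrrD; have := sqr_ge0 b; have := sqr_ge0 C; lra.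
  by split; [apply: sqB (fC L x)|apply: sqB; rewrite addrC; exact: fC L x].
have [U [UU Uoo]] := ultraFilterLemma eventually_filter.
have PU : ProperFilter U := @ultra_proper _ _ UU.
have near_box (x : Z2) : \forall L \near U, (`|x.1| <= L)%N /\ (`|x.2| <= L)%N.
  apply: Uoo; exists (maxn `|x.1| `|x.2|) => // L /=; lia.
have lims x : exists a, cvg_parts U (f ^~ x) a.
  have [a ha] := ultra_bounded_cvg U _ _ UU (fun L => (fB L x).1).
  by have [b hb] := ultra_bounded_cvg U _ _ UU (fun L => (fB L x).2);
    exists (Complex a b).
pose h x := sval (cid (lims x)).
have hf x : cvg_parts U (f ^~ x) (h x) by rewrite /h; case: cid.
exists h; split.
  move=> s us; apply: (cvgr_to_le (cvg_sum_sqmod U s _ _ hf)).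
  (* Once the torus is larger than a box around [s], projection is injective on [s], so the partial
     sum is at most the whole torus mass. *)
  have [N sN] := seq_box s.
  apply: Uoo; exists N => // L /= NL; rewrite (le_trans _ (FC L))//.
  rewrite -(big_map (torus_proj L) xpredT (fun t => sqmod (F L t)))
    -[leRHS]big_enum.
  apply: ler_sum_subset => [|t _|t]; [|by rewrite mem_enum|exact: sqmod_ge0].
  rewrite map_inj_in_uniq// => x y /sN[x1 x2] /sN[y1 y2].
  move/(congr1 (torus_rep L)).
  by rewrite !torus_rep_proj// ?(leq_trans _ NL).
apply/funext => x; rewrite /shift_by HtriE -mulNr.
(* At each site the equation holds exactly for all large [L]; as it involves finitely many sites, it
   passes to the limit. *)
apply: (@cvg_parts_near_cst _ _ U _ (fun L => shift (f L) x)); last first.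
  by apply: filterS (near_box x) => L [x1 x2]; exact: fE.
rewrite /shift_by; under eq_fun do rewrite HtriE -mulNr.
apply: cvg_partsD; [apply: cvg_partsD|]; [|exact: cvg_partsZ|exact: cvg_partsZ].
exact: cvg_parts_sum.
Qed.

(** Cut off to a large torus, [f] violates the equation only near the seam, where its mass is small;
    [torus_bound] then makes [f] itself small. *)
Lemma shift_by_inj0 f : ell2 f -> (forall x, shift f x = 0) -> forall x, f x = 0.
Proof.
move=> f2 f0 x0; apply: sqmod_eq0; apply/eqP; rewrite eq_le sqmod_ge0 andbT.
pose k := 2 * (2 ^+ 6 + 2 * (l ^+ 2 + sqmod z)).
have k0 : 0 < k.
  rewrite mulr_gt0// ltr_pwDl ?exprn_gt0// mulr_ge0// addr_ge0 ?sqmod_ge0//.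
  exact: sqr_ge0.
have c20 : 0 < c ^+ 2 by rewrite exprn_gt0.
suff small eps : 0 < eps -> c ^+ 2 * sqmod (f x0) <= k * 7 * eps.
  rewrite leNgt; apply/negP => fx0.
  (* With this [eps] the bound [k * 7 * eps] is half of the left side; [7] counts a site and its six
     neighbours. *)
  have e0 : 0 < c ^+ 2 * sqmod (f x0) / (k * 14).
    by apply: divr_gt0; apply: mulr_gt0.
  have := small _ e0; rewrite leNgt => /negP; apply.
  have -> : k * 7 * (c ^+ 2 * sqmod (f x0) / (k * 14)) =
      c ^+ 2 * sqmod (f x0) / 2 by field; rewrite gt_eqF.
  by rewrite ltr_pdivrMr// ltr_pMr ?ltr1n//; apply: mulr_gt0.
move=> e0; have [s0 us0 tail] := ell2_tail f eps f2 e0.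
have [N sN] := seq_box (x0 :: s0).
(* Sites up to radius [N + 1] are considered, and their neighbours must still have coordinates at
   most [L]. *)
pose L := N.+2; pose F := f \o torus_rep L.
pose out (x : Z2) := ~~ ((`|x.1| <= N)%N && (`|x.2| <= N)%N).
pose G t : R := if out (torus_rep L t) then sqmod (F t) else 0.
have G0 t : 0 <= G t by rewrite /G; case: ifP => // _; exact: sqmod_ge0.
have GE : \sum_t G t <= eps.
  rewrite /G -big_mkcond -big_filter.
  rewrite -(big_map (torus_rep L) xpredT (fun x => sqmod (f x))).
  apply: tail.
    by rewrite map_inj_uniq ?filter_uniq ?index_enum_uniq//; exact: torus_rep_inj.
  apply/hasPn => x /mapP[t]; rewrite mem_filter => /andP[ot _ ->].
  apply/negP => /= ts; have [h1 h2] := sN _ (mem_behead (s := x0 :: s0) ts).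
  by rewrite /out h1 h2 in ot.
(* Up to radius [N + 1] the equation holds exactly; farther out, the site and all its neighbours lie
   outside the box of radius [N], where [G] records the mass. *)
have loc t : sqmod (torus_op l L F t - z * F t) <=
    k * \sum_(e <- 0 :: nbrs) G (t + torus_proj L e).
  have repD e : e \in 0 :: nbrs -> (`|(torus_rep L t).1| <= N.+1)%N ->
      (`|(torus_rep L t).2| <= N.+1)%N ->
      torus_rep L (t + torus_proj L e) = torus_rep L t + e.
    move=> he t1 t2; rewrite -{1}(torus_repK L t) -torus_projD.
    by have [] := absz_add_nbr _ _ _ he t1 t2; exact: torus_rep_proj.
  have [tin|tout] := boolP ((`|(torus_rep L t).1| <=
    N.+1)%N && (`|(torus_rep L t).2| <= N.+1)%N).
    have /andP[t1 t2] := tin.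
    have -> : torus_op l L F t - z * F t = shift f (torus_rep L t).
      rewrite /shift_by HtriE /torus_op; congr (_ + _ - _).
      rewrite big_seq [RHS]big_seq; apply: eq_bigr => e he; rewrite /F /= repD//.
      by rewrite inE he orbT.
    by rewrite f0 sqmod0 mulr_ge0 ?(ltW k0)// sumr_ge0.
  have := sqmod_local z (l * potential R (torus_rep L t)) (fun e =>
    F (t + torus_proj L e)).
  have p0 : torus_proj L 0 = 0 by [].
  rewrite exprMn potential_sqr mulr1 p0 addr0 => /le_trans; apply.
  rewrite -/k ler_wpM2l ?(ltW k0)// big_seq [leRHS]big_seq; apply: ler_sum => e he.
  rewrite /G ifT// /out; apply: contra tout => /andP[h1 h2].
  have -> : t = (t + torus_proj L e) + torus_proj L (- e).
    by rewrite -addrA -torus_projD subrr p0 addr0.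
  have heN : - e \in 0 :: nbrs.
    by move: he; rewrite /nbrs !inE; do 6?[case/predU1P => [->//|]]; move=> /eqP ->.
  have [g1 g2] := absz_add_nbr _ _ _ heN h1 h2.
  have -> : torus_rep L (t + torus_proj L e + torus_proj L (- e)) =
      torus_rep L (t + torus_proj L e) - e.
    rewrite -{1}(torus_repK L (t + torus_proj L e)) -torus_projD.
    by apply: torus_rep_proj; exact: leqW.
  by rewrite g1 g2.
have := torus_bound l L z c zc F (ltW c0).
move=> /le_trans/(_ (ler_sum _ (fun t _ => loc t))).
rewrite -mulr_sumr exchange_big /=.
have tr e : \sum_(t : 'Z_(L.*2.+2) * 'Z_(L.*2.+2)) G (t + torus_proj L e)
  = \sum_t G t.
  rewrite [RHS](reindex (fun t : 'Z_(L.*2.+2) * 'Z_(L.*2.+2) =>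
    t + torus_proj L e))//=.
  by apply: onW_bij; exists (fun t => t - torus_proj L e) => t;
    rewrite ?addrK ?subrK.
rewrite [X in _ <= k * X](eq_bigr (fun=> \sum_t G t)) => [|e _]; last exact: tr.
rewrite big_const_seq count_predT iter_addr_0 -[_ *+ _]mulr_natr => h.
rewrite (@le_trans _ _ (c ^+ 2 * \sum_t sqmod (F t)))//.
  rewrite ler_wpM2l ?(ltW c20)// (bigD1 (torus_proj L x0))//= /F /=.
  have [x1 x2] := sN x0 (mem_head _ _).
  have NL : (N <= L)%N by rewrite /L -addn2 leq_addr.
  rewrite torus_rep_proj ?lerDl ?(leq_trans _ NL)//.
  by rewrite sumr_ge0// => t _; exact: sqmod_ge0.
rewrite (le_trans h)// -mulrA ler_wpM2l ?(ltW k0)// mulrC ler_wpM2l//.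
Qed.

Lemma shift_by_linear (a : R[i]) psi phi :
  shift (fun x => a * psi x + phi x) = (fun x => a * shift psi x + shift phi x).
Proof.
apply/funext => x; rewrite /shift_by !HtriE big_split /= -mulr_sumr; ring.
Qed.

Lemma ell2_linear (a : R[i]) (psi phi : Z2 -> R[i]) : ell2 psi -> ell2 phi ->
  ell2 (fun x => a * psi x + phi x).
Proof.
move=> /ell2_mass_le h1 /ell2_mass_le h2.
apply: (mass_le_ell2 _ (2 * (sqmod a * norm2 psi ^+ 2 + norm2 phi ^+ 2))) => s us.
apply: (@le_trans _ _ (\sum_(x <- s) 2 * (sqmod a * sqmod (psi x)
  + sqmod (phi x)))).
  by apply: ler_sum => x _; rewrite (le_trans (sqmodD _ _))// sqmodM.
rewrite -mulr_sumr ler_wpM2l// big_split /= -mulr_sumr lerD ?h2//.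
by rewrite ler_wpM2l ?sqmod_ge0// h1.
Qed.

Lemma shift_by_inj f g : ell2 f -> ell2 g -> shift f = shift g -> f = g.
Proof.
move=> f2 g2 fg; apply/funext => x; apply/eqP; rewrite -subr_eq0 addrC -mulN1r.
apply/eqP; apply: (shift_by_inj0 _ (ell2_linear (-1) _ _ g2 f2)) => y.
by rewrite shift_by_linear fg mulN1r addNr.
Qed.

(** Solvability defines [S] on [ell2], with an arbitrary value elsewhere; uniqueness makes it linear
    and a left inverse, and the mass bound gives norm at most [c^-1]. *)
Lemma resolvent_criterion : resolvent_set (Htri l) z.
Proof.
pose S (g : Z2 -> R[i]) := if pselect (ell2 g) is left g2
  then sval (cid (shift_by_solution g g2)) else g.
have SP g : ell2 g -> mass_le (S g) ((c ^+ 2)^-1 * norm2 g ^+ 2) /\ shift (S g) = g.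
  by move=> g2; rewrite /S; case: pselect => // g2'; case: cid.
have S2 g : ell2 g -> ell2 (S g) by move=> /SP[/mass_le_ell2].
exists S; last first.
  move=> psi psi2; split; last by have [] := SP _ psi2.
  have sh2 := ell2_shift_by l z psi psi2.
  by apply: shift_by_inj => //; [exact: S2|have [] := SP _ sh2].
split=> //.
  move=> a psi phi psi2 phi2; have ap2 := ell2_linear a _ _ psi2 phi2.
  apply: shift_by_inj; [exact: S2|by apply: ell2_linear; exact: S2|].
  rewrite shift_by_linear (SP _ ap2).2; apply/funext => x.
  by rewrite (SP _ psi2).2 (SP _ phi2).2.
exists c^-1 => psi psi2; have [/mass_le_norm2 h _] := SP _ psi2.
rewrite -(@ler_pXn2r _ 2)// ?nnegrE ?mulr_ge0 ?invr_ge0 ?sqrtr_ge0 ?(ltW c0)//.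
by rewrite exprMn exprVn.
Qed.

End resolvent.

(** * Spectrum and gap *)

Section real_line_in_plane.
Context {R : realType}.

Lemma normr_realC (x : R) : `|x%:C| = `|x|%:C.
Proof. by rewrite normc_def /= expr0n addr0 sqrtr_sqr. Qed.

Lemma normr_Re_le (z : R[i]) : `|complex.Re z|%:C <= `|z|.
Proof. by rewrite normc_def lecR -sqrtr_sqr ler_wsqrtr// lerDl sqr_ge0. Qed.

Lemma normr_Im_le (z : R[i]) : `|complex.Im z|%:C <= `|z|.
Proof. by rewrite normc_def lecR -sqrtr_sqr ler_wsqrtr// lerDr sqr_ge0. Qed.

Lemma gt0_complexP (e : R[i]) : 0 < e -> exists2 d : R, 0 < d & e = d%:C.
Proof.
by case: e => a b; rewrite ltcE /= => /andP[/eqP -> a0]; exists a.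
Qed.

Lemma continuous_realC : continuous (fun x : R => x%:C : R[i]^o).
Proof.
move=> x; apply/cvgrPdist_lt => e /gt0_complexP[d d0 ->].
near=> y; rewrite -rmorphB normr_realC ltcR; near: y.
exact: cvgr_dist_lt.
Unshelve. all: by end_near. Qed.

Lemma continuous_Re : continuous (fun z : R[i]^o => complex.Re z : R).
Proof.
move=> z.
apply/(@cvgrPdist_lt R R R[i]^o (nbhs z) (@nbhs_filter _ z)) => e e0.
have e0' : (0 : R[i]) < e%:C by rewrite ltcR.
have : \forall w \near z, `|z - w| < e%:C by apply/nbhs_ballP; exists e%:C.
apply: filterS => w zw.
by rewrite -raddfB -ltcR (le_lt_trans (normr_Re_le _)).
Qed.

End real_line_in_plane.

Lemma card_pair {T : Type} (A B : set T) : A <> B ->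
  ([set S | S = A \/ S = B] #= `I_2)%card.
Proof.
move=> AB; apply/card_set_bijP.
exists (fun S => if pselect (S = A) then 0%N else 1%N); split.
- by move=> S [] -> /=; case: pselect.
- by move=> S S' /set_mem[] -> /set_mem[] -> /=; do ?case: pselect.
- move=> [|[|//]] _ /=; first by exists A; [left|case: (pselect (A = A))].
  by exists B; [right|case: (pselect (B = A)) => // BA; case: AB].
Qed.

Section spectrum.
Context {R : realType} (l : R).
Implicit Types E : R.

Let sigma : set R[i]^o := spectrum (Htri l).

(** Bloch energies are real, so a nonreal [z] stays at distance at least [|Im z|] from them. *)
Lemma spectrum_real (z : R[i]) : sigma z -> z = (complex.Re z)%:C.
Proof.
move=> sz; case: (eqVneq (complex.Im z) 0) => [z0|z0].
  by case: z z0 {sz} => a b /= ->.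
exfalso; apply: sz; apply: (resolvent_criterion l z `|complex.Im z|).
  by rewrite normr_gt0.
move=> E _; apply: le_trans (normr_Im_le _).
by rewrite raddfB /= sub0r normrN.
Qed.

(** This is the contrapositive of [resolvent_criterion]: real spectral points lie in the closure of
    the Bloch spectrum. *)
Lemma spectrum_bloch_near E (e : R) : sigma E%:C -> 0 < e ->
  exists2 E', bloch_spectrum l E' & `|E' - E| < e.
Proof.
move=> sE e0; apply: contrapT => nE; apply: sE.
apply: (resolvent_criterion l E%:C e) => // E' bE'.
rewrite -rmorphB normr_realC lecR leNgt; apply/negP => lt; apply: nE.
by exists E'.
Qed.

Lemma spectrum_gap E : 0 < l -> l / 2 - 2 < E -> E < l - 2 -> ~ sigma E%:C.
Proof.
move=> l0 E1 E2 sE.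
have e0 : 0 < Num.min (E - (l / 2 - 2)) (l - 2 - E) by rewrite lt_min !subr_gt0 E1.
have [E' bE'] := spectrum_bloch_near _ _ sE e0.
rewrite lt_min !ltr_norml => /andP[/andP[h1 h2] /andP[h3 h4]].
by apply: (bloch_gap l E') bE' => //; lra.
Qed.

Lemma spectrum_low_interval E0 E E1 : 0 < l -> sigma E0%:C -> sigma E1%:C ->
  E0 < E -> E < E1 -> E1 <= l / 2 - 2 -> sigma E%:C.
Proof.
move=> l0 s0 s1 E0E EE1 E1l; apply: bloch_sub_spectrum.
have [|e0 b0] := spectrum_bloch_near _ (E - E0) s0; first by rewrite subr_gt0.
rewrite ltr_norml => /andP[h1 h2].
(* The first bound keeps the Bloch energy above [E], the second keeps it below [l - 2]. *)
have e10 : 0 < Num.min (E1 - E) (l / 2) by rewrite lt_min subr_gt0 EE1 divr_gt0.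
have [e1 b1] := spectrum_bloch_near _ _ s1 e10.
rewrite lt_min !ltr_norml => /andP[/andP[h3 h4] /andP[h5 h6]].
by apply: (bloch_low_interval l e0 E e1) => //; lra.
Qed.

Lemma spectrum_high_interval E0 E E1 : 0 < l -> sigma E1%:C ->
  l - 2 <= E0 -> E0 < E -> E < E1 -> sigma E%:C.
Proof.
move=> l0 s1 lE0 E0E EE1; apply: bloch_sub_spectrum.
have [|e1 b1] := spectrum_bloch_near _ (E1 - E) s1; first by rewrite subr_gt0.
rewrite ltr_norml => /andP[h1 h2].
by apply: (bloch_high_interval l E0 E e1) => //; lra.
Qed.

Definition low_spectrum : set R[i]^o :=
  [set z | sigma z /\ complex.Re z <= l / 2 - 2].

Definition high_spectrum : set R[i]^o :=
  [set z | sigma z /\ l - 2 <= complex.Re z].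

Lemma connected_real_subset (A : set R[i]^o) (J : set R) :
  (forall z, A z -> sigma z) ->
  (forall z, A z -> J (complex.Re z)) -> (forall E, J E -> A E%:C) ->
  is_interval J -> connected A.
Proof.
move=> As AJ JA Ji; have -> : A = (fun x : R => x%:C : R[i]^o) @` J.
  apply/seteqP; split => [z Az|_ [E JE <-]]; last exact: JA.
  by exists (complex.Re z); [exact: AJ|rewrite -(spectrum_real _ (As _ Az))].
apply: connected_continuous_connected; first exact/connected_intervalP.
exact/continuous_subspaceT/continuous_realC.
Qed.

Lemma connected_low : 0 < l -> connected low_spectrum.
Proof.
move=> l0; apply: (@connected_real_subset _ [set E | sigma E%:C /\ E <= l / 2 - 2]).
- by move=> z [].
- by move=> z [sz zl]; split => //; rewrite -(spectrum_real _ sz).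
- by move=> E.
- apply/is_intervalPlt => x y [sx xl] [sy yl] E /andP[xE Ey]; split.
    exact: (spectrum_low_interval x E y).
  by rewrite (le_trans (ltW Ey)).
Qed.

Lemma connected_high : 0 < l -> connected high_spectrum.
Proof.
move=> l0; apply: (@connected_real_subset _ [set E | sigma E%:C /\ l - 2 <= E]).
- by move=> z [].
- by move=> z [sz zl]; split => //; rewrite -(spectrum_real _ sz).
- by move=> E.
- apply/is_intervalPlt => x y [sx xl] [sy yl] E /andP[xE Ey]; split.
    exact: (spectrum_high_interval x E y).
  by rewrite (le_trans xl) ?ltW.
Qed.

Lemma spectrum_low_or_high z : 0 < l -> sigma z ->
  low_spectrum z \/ high_spectrum z.
Proof.
move=> l0 sz; have [|h1] := leP (complex.Re z) (l / 2 - 2); first by left.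
have [|h2] := leP (l - 2) (complex.Re z); first by right.
by exfalso; apply: (spectrum_gap (complex.Re z)) => //;
  rewrite -(spectrum_real _ sz).
Qed.

Lemma connected_spectrum_side (C : set R[i]^o) z w : 0 < l -> connected C ->
  (forall u, C u -> sigma u) -> C z -> C w ->
  complex.Re z <= l / 2 - 2 -> complex.Re w < l - 2.
Proof.
move=> l0 Cc Cs Cz Cw zl; rewrite ltNge; apply/negP => wl.
have /connected_intervalP Ci : connected ((fun u : R[i]^o => complex.Re u : R)
  @` C).
  apply: connected_continuous_connected Cc _.
  exact/continuous_subspaceT/continuous_Re.
(* The chosen real part is the midpoint of the free interval between [l / 2 - 2] and [l - 2]. *)
have [u Cu uE] : ((fun u : R[i]^o => complex.Re u : R) @` C) (3 / 4 * l - 2).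
  by apply: (Ci (complex.Re z) (complex.Re w)); [exists z|exists w|lra].
have su : sigma (complex.Re u)%:C by rewrite -spectrum_real; exact: Cs.
by apply: (spectrum_gap _ _ _ _ su) => //; rewrite uE; lra.
Qed.

Lemma component_low z : 0 < l -> low_spectrum z ->
  connected_component sigma z = low_spectrum.
Proof.
move=> l0 lz; apply/seteqP; split; last first.
  by apply: connected_component_max (connected_low l0) => // w [].
move=> w zw; have sw : sigma w := connected_component_sub zw.
have [//|[_ wl]] := spectrum_low_or_high _ l0 sw.
have := connected_spectrum_side _ z w l0 (@component_connected _ sigma z)
  (@connected_component_sub _ sigma z) _ zw lz.2.
by rewrite ltNge wl => /(_ (connected_component_refl lz.1)).
Qed.

Lemma component_high z : 0 < l -> high_spectrum z ->
  connected_component sigma z = high_spectrum.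
Proof.
move=> l0 hz; apply/seteqP; split; last first.
  by apply: connected_component_max (connected_high l0) => // w [].
move=> w zw; have sw : sigma w := connected_component_sub zw.
have [lw|//] := spectrum_low_or_high _ l0 sw.
have := connected_spectrum_side _ w z l0 (@component_connected _ sigma z)
  (@connected_component_sub _ sigma z) zw _ lw.2.
by rewrite ltNge hz.2 => /(_ (connected_component_refl hz.1)).
Qed.

(** The edge is at most [-2], hence below [l - 2]; as it is spectral, [spectrum_gap] forces it below
    [l / 2 - 2]. *)
Lemma low_edge : 0 < l -> low_spectrum (- Num.sqrt (4 + l ^+ 2))%:C.
Proof.
move=> l0; have s := bloch_sub_spectrum _ _ (bloch_edge_low l).
split => //=; rewrite leNgt; apply/negP => lt.
apply: (spectrum_gap (- Num.sqrt (4 + l ^+ 2))) => //.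
have : 2 <= Num.sqrt (4 + l ^+ 2).
  rewrite -(@ler_pXn2r _ 2)// ?nnegrE ?sqrtr_ge0// sqr_sqrtr.
    by have := sqr_ge0 l; lra.
  by rewrite addr_ge0// sqr_ge0.
lra.
Qed.

Lemma high_edge : high_spectrum (-2 + l)%:C.
Proof. by split; [exact/bloch_sub_spectrum/bloch_edge_high|rewrite /= addrC]. Qed.

Lemma components_spectrum : 0 < l -> (components sigma #= `I_2)%card.
Proof.
move=> l0; have -> : components sigma = [set S | S = low_spectrum \/ S =
  high_spectrum].
  apply/seteqP; split => [_ [z sz <-]|S [] ->].
  - have [lz|hz] := spectrum_low_or_high _ l0 sz.
      by left; exact: component_low.
    by right; exact: component_high.
  - by exists (- Num.sqrt (4 + l ^+ 2))%:C;
    [exact: (low_edge l0).1|exact: component_low (low_edge l0)].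
  - by exists (-2 + l)%:C; [exact: high_edge.1|exact: component_high high_edge].
apply: card_pair => lh; have := low_edge l0; rewrite lh => -[_ /=].
by have [_ /=] := low_edge l0; lra.
Qed.

(** A spectral point strictly between the edges would have Bloch energies there too; since both
    edges are spectral, a connected set around [-2] cannot reach past them. *)
Lemma gap_small : 0 < l -> l < 1 / 2 ->
  gap l = `](- Num.sqrt (4 + l ^+ 2)), (-2 + l)[%classic.
Proof.
move=> l0 l1; set a := - Num.sqrt _; set b := -2 + l.
have a2 : a < -2.
  rewrite /a ltrN2 -(@ltr_pXn2r _ 2)// ?nnegrE ?sqrtr_ge0// sqr_sqrtr.
    by have := exprn_gt0 2 l0; lra.
  by rewrite addr_ge0// sqr_ge0.
have b2 : -2 < b by rewrite /b ltrDl.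
have inside E : a < E -> E < b -> ~ sigma E%:C.
  move=> aE Eb sE.
  have e0 : 0 < Num.min (E - a) (b - E) by rewrite lt_min !subr_gt0 aE.
  have [E' bE'] := spectrum_bloch_near _ _ sE e0.
  rewrite lt_min !ltr_norml => /andP[/andP[h1 h2] /andP[h3 h4]].
  apply: (bloch_gap_small l E' l0 l1 _ _ bE'); first by rewrite -/a; lra.
  by rewrite /b in h3 h4; lra.
rewrite /gap; apply/seteqP; split; last first.
  apply: connected_component_max; first by rewrite /= in_itv /= a2.
    by move=> E; rewrite /= in_itv /= => /andP[aE Eb]; exact: inside.
  exact/connected_intervalP/interval_is_interval.
set C := connected_component _ _.
have C2 : C (-2) by apply: connected_component_refl; exact: inside.
have /connected_intervalP Ci : connected C by exact: component_connected.
have Cs E : C E -> ~ sigma E%:C by move/connected_component_sub.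
move=> E CE; rewrite /= in_itv /=; apply/andP; split; rewrite ltNge;
  apply/negP => h.
  by apply: (Cs a); [apply: (Ci E (-2)) => //;
    rewrite h ltW|exact: (low_edge l0).1].
by apply: (Cs b); [apply: (Ci (-2) E) => //; rewrite h ltW|exact: high_edge.1].
Qed.

Lemma gap_length_small : 0 < l -> l < 1 / 2 ->
  gap_length l = (l + (Num.sqrt (4 + l ^+ 2) - 2))%:E.
Proof.
move=> l0 l1; rewrite /gap_length gap_small// lebesgue_measure_itv /= lte_fin.
rewrite ifT; first by rewrite -EFinB opprK; congr EFin; ring.
have : 0 <= Num.sqrt (4 + l ^+ 2) - 2.
  rewrite subr_ge0 -(@ler_pXn2r _ 2)// ?nnegrE ?sqrtr_ge0// sqr_sqrtr.
    by have := sqr_ge0 l; lra.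
  by rewrite addr_ge0// sqr_ge0.
lra.
Qed.

End spectrum.

(** * Asymptotics of the gap length *)

Lemma sqrt_4_bounds {R : realType} (l : R) :
  0 <= Num.sqrt (4 + l ^+ 2) - 2 <= l ^+ 2 / 4.
Proof.
have s0 : 0 <= 4 + l ^+ 2 by rewrite addr_ge0// sqr_ge0.
have l4 : 0 <= l ^+ 2 / 4 by rewrite divr_ge0// sqr_ge0.
rewrite subr_ge0 lerBlDr; apply/andP; split.
  rewrite -(@ler_pXn2r _ 2)// ?nnegrE ?sqrtr_ge0// sqr_sqrtr//.
  by have := sqr_ge0 l; lra.
(* The square of [2 + l ^ 2 / 4] exceeds [4 + l ^ 2] by [(l ^ 2 / 4) ^ 2]. *)
rewrite -(@ler_pXn2r _ 2)// ?nnegrE ?sqrtr_ge0//; last by rewrite addr_ge0.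
by rewrite sqr_sqrtr// sqrrD; have := sqr_ge0 (l ^+ 2 / 4); lra.
Qed.

(** A relative error of at most [l] suffices, which reduces both equivalences to polynomial
    inequalities. *)
Lemma asymp_equiv0_of_dist {R : realType} (f g : R -> R) :
  (\forall l \near (0 : R)^'+, 0 < g l /\ `|f l - g l| <= l * g l) ->
  asymp_equiv0 f g.
Proof.
move=> fg; apply/cvgrPdist_le => e e0.
near=> l.
have [g0 fgl] : 0 < g l /\ `|f l - g l| <= l * g l by near: l.
have le : l <= e by near: l; exact: nbhs_right_ltW.
rewrite -(divff (lt0r_neq0 g0)) -mulrBl normrM distrC normfV (gtr0_norm g0).
by rewrite ler_pdivrMr// (le_trans fgl)// ler_wpM2r// ltW.
Unshelve. all: by end_near. Qed.

Local Close Scope complex_scope.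

Theorem theorem3p5 (R : realType) :
  (forall l : R, 0 < l -> (components (spectrum (Htri l)) #= `I_2)%card) /\
  (\forall l \near (0 : R)^'+,
     gap l = `](- Num.sqrt (4 + l ^+ 2)), (-2 + l)[%classic /\
     gap_length l = (l + (Num.sqrt (4 + l ^+ 2) - 2))%:E) /\
  asymp_equiv0 (fun l : R => fine (gap_length l))
               (fun l : R => l + l ^+ 2 / 2) /\
  asymp_equiv0 (fun l : R => fine (gap_length l)) (fun l : R => l).
Proof.
have near0 : \forall l \near (0 : R)^'+, 0 < l /\ l < 1 / 2.
  near=> l; split; near: l; first exact: nbhs_right_gt.
  exact: nbhs_right_lt.
split; first exact: components_spectrum.
split; first by apply: filterS near0 => l [l0 l1]; rewrite gap_small// gap_length_small.
split; apply: asymp_equiv0_of_dist; apply: filterS near0 => l [l0 l1];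
  rewrite gap_length_small//=; have /andP[s0 s1] := sqrt_4_bounds l;
  have l20 : 0 < l ^+ 2 by rewrite exprn_gt0.
  split; first by rewrite addr_gt0// divr_gt0.
  have l30 : 0 <= l * (l ^+ 2 / 2) by rewrite mulr_ge0 ?divr_ge0 ?ltW.
  (* The error is the distance from [sqrt (4 + l ^ 2) - 2] to [l ^ 2 / 2], at most [l ^ 2 / 2], and
     [l * (l + l ^ 2 / 2)] dominates it. *)
  by rewrite mulrDr -expr2 ler_norml; lra.
split => //.
by rewrite addrAC subrr add0r ger0_norm// -expr2; lra.
Unshelve. all: by end_near. Qed.
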